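(* Let $S$ be a compact operator on $L^2(\mathbb{R}^d)$, let $p\in[1,\infty)$, and let $\Omega\subset\mathbb{R}^{2d}$ be measurable with $0<|\Omega|<\infty$. The concentration functional $$J_S\colon L^2(\mathbb{R}^d)\to[0,+\infty),\qquad J_S(f)=\left(\int_\Omega |Q_Sf(z)|^p\,dz\right)^{1/p}$$ is sequentially weakly continuous on $L^2(\mathbb{R}^d)$. As a consequence, the supremum $$\Lambda_{p,\Omega}(S)=\sup_{f\in L^2(\mathbb{R}^d)\setminus\{0\}}\frac{\|Q_Sf\|_{L^p(\Omega)}}{\|f\|_{L^2}^2}$$ is attained. Furthermore, if $S\neq 0$, then any normalized maximizing sequence (that is, any sequence $(f_n)$ with $\|f_n\|_{L^2}=1$ and $J_S(f_n)\to\Lambda_{p,\Omega}(S)$) has a subsequence converging strongly in $L^2(\mathbb{R}^d)$ to a maximizer.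
   Context: $L^2(\mathbb{R}^d)$ is the complex Hilbert space with inner product linear in the first entry, and $|\Omega|$ denotes Lebesgue measure. For $z=(x,\xi)\in\mathbb{R}^{2d}$, the time-frequency shift is $\pi(z)f(y)=e^{2\pi i\xi\cdot y}f(y-x)$, and for a bounded operator $S$ on $L^2(\mathbb{R}^d)$ the operator shift is $\alpha_z(S)=\pi(z)S\pi(z)^*$. The Cohen-class distribution with window operator $S$ is $Q_Sf(z)=\langle\alpha_z(S)f,f\rangle$, for $f\in L^2(\mathbb{R}^d)$ and $z\in\mathbb{R}^{2d}$. *)

(* Defs.v *)
From HB Require Import structures.
From mathcomp Require Import all_boot all_order all_algebra ring_quotient.
From mathcomp Require Import all_classical all_reals all_analysis.
From mathcomp Require Import measurable_realfun complex.
Set Implicit Arguments.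
Unset Strict Implicit.
Unset Printing Implicit Defensive.
Import Order.TTheory GRing.Theory Num.Theory.
Import numFieldNormedType.Exports.
Local Open Scope classical_set_scope.
Local Open Scope ring_scope.
Local Open Scope complex_scope.

(* 'rV[R]_d carries the sigma-algebra generated by its coordinates, which is
   the Borel one. *)
Definition rV_display : measure_display. Proof. exact: default_measure_display. Qed.

Section measurable_rV.
Variables (R : realType) (d : nat).

Let coord (i : 'I_d) (x : 'rV[R]_d) : R := x ord0 i.

Let rV_set0 : g_sigma_preimage coord set0.
Proof. exact: sigma_algebra0. Qed.

Let rV_setC A : g_sigma_preimage coord A -> g_sigma_preimage coord (~` A).
Proof. exact: sigma_algebraC. Qed.

Let rV_bigcup (F : _^nat) : (forall i, g_sigma_preimage coord (F i)) ->
  g_sigma_preimage coord (\bigcup_i (F i)).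
Proof. exact: sigma_algebra_bigcup. Qed.

HB.instance Definition _ := @isMeasurable.Build rV_display
  'rV[R]_d (g_sigma_preimage coord) rV_set0 rV_setC rV_bigcup.

Lemma measurable_coord (i : 'I_d) :
  measurable_fun [set: 'rV[R]_d] (fun x : 'rV[R]_d => x ord0 i).
Proof.
move=> _ Y mY; rewrite setTI; apply: sub_sigma_algebra => /=.
rewrite -bigcup_seq/=; exists i => /=; first by rewrite mem_index_enum.
by exists Y => //; rewrite setTI.
Qed.

Lemma measurable_fun_rVP dT (T : measurableType dT) (f : T -> 'rV[R]_d) :
  measurable_fun [set: T] f <->
  forall i, measurable_fun [set: T] (fun t => f t ord0 i).
Proof.
split=> [mf i|mf].
  exact: (measurableT_comp (measurable_coord i)).
apply: (@measurability _ _ _ _ _ _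
  (\big[setU/set0]_(i < d) preimage_set_system setT (coord i) measurable)) => //.
move=> _ [A + <-]; rewrite -bigcup_seq/= => -[i _] [B mB <-].
rewrite !setTI -comp_preimage.
rewrite -[X in measurable X]setTI; exact: mf.
Qed.

End measurable_rV.

Section rV_cons.
Variables (R : realType) (d : nat).

Definition rV_cons (p : R * 'rV[R]_d) : 'rV[R]_d.+1 := row_mx p.1%:M p.2.
Definition rV_uncons (x : 'rV[R]_d.+1) : R * 'rV[R]_d :=
  (x ord0 ord0, \row_i x ord0 (lift ord0 i)).

Lemma rV_cons0 p : rV_cons p ord0 ord0 = p.1.
Proof. by rewrite /rV_cons mxE; case: splitP => // j _; rewrite [j]ord1 mxE. Qed.

Lemma rV_consS p i : rV_cons p ord0 (lift ord0 i) = p.2 ord0 i.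
Proof.
rewrite /rV_cons mxE; case: splitP => [j|k /= ik].
  by rewrite ord1/= /bump.
by congr (p.2 _ _); apply/val_inj; case: ik.
Qed.

Lemma rV_consK : cancel rV_cons rV_uncons.
Proof.
move=> [a x]; rewrite /rV_uncons rV_cons0; congr pair.
by apply/rowP => i; rewrite mxE rV_consS.
Qed.

Lemma rV_unconsK : cancel rV_uncons rV_cons.
Proof.
move=> x; apply/rowP => i.
have [j ->|->] := unliftP ord0 i; last by rewrite rV_cons0.
by rewrite rV_consS mxE.
Qed.

Lemma measurable_rV_cons : measurable_fun [set: R * 'rV[R]_d] rV_cons.
Proof.
apply/measurable_fun_rVP => i; have [j ->|->] := unliftP ord0 i.
  under eq_fun do rewrite rV_consS.
  exact: (measurableT_comp (measurable_coord j)).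
by under eq_fun do rewrite rV_cons0; exact: measurable_fst.
Qed.

Lemma measurable_rV_uncons : measurable_fun [set: 'rV[R]_d.+1] rV_uncons.
Proof.
apply: measurable_fun_pair; first exact: measurable_coord.
apply/measurable_fun_rVP => i; under eq_fun do rewrite /= mxE.
exact: measurable_coord.
Qed.

End rV_cons.

Section lebesgue_rV_step.
Variables (R : realType) (d : nat).
Variable m : {sigma_finite_measure set 'rV[R]_d -> \bar R}.

Definition lebesgue_rV_step : set 'rV[R]_d.+1 -> \bar R :=
  pushforward (@lebesgue_measure R \x m)%E (@rV_cons R d).

Let step0 : lebesgue_rV_step set0 = 0%E.
Proof. by rewrite /lebesgue_rV_step /pushforward preimage_set0 measure0. Qed.

Let step_ge0 A : (0 <= lebesgue_rV_step A)%E.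
Proof. by rewrite /lebesgue_rV_step /pushforward; exact: measure_ge0. Qed.

Let step_sigma_additive : semi_sigma_additive lebesgue_rV_step.
Proof.
rewrite /lebesgue_rV_step.
pose P := measure_function_pushforward__canonical__measure_function_Measure
    (@lebesgue_measure R \x m)%E (@measurable_rV_cons R d).
exact: (@measure_semi_sigma_additive _ _ _ P).
Qed.

HB.instance Definition _ := isMeasure.Build _ _ _ lebesgue_rV_step
  step0 step_ge0 step_sigma_additive.

Let step_sigma_finite : sigma_finite setT lebesgue_rV_step.
Proof.
have /sigma_finiteP[F [TF ndF Foo]] := sigma_finiteT (@lebesgue_measure R).
have /sigma_finiteP[G [TG ndG Goo]] := sigma_finiteT m.
exists (fun n => @rV_uncons R d @^-1` (F n `*` G n)).
  apply/seteqP; split => // x _.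
  have : (\bigcup_i F i) (rV_uncons x).1 by rewrite -TF.
  have : (\bigcup_i G i) (rV_uncons x).2 by rewrite -TG.
  move=> [k _ Gk] [n _ Fn]; exists (maxn n k) => //; split.
  - by move: Fn; exact/subsetPset/ndF/leq_maxl.
  - by move: Gk; exact/subsetPset/ndG/leq_maxr.
move=> n; have [mF Fn] := Foo n; have [mG Gn] := Goo n; split.
  rewrite -[X in measurable X]setTI; apply: measurable_rV_uncons => //.
  exact: measurableX.
rewrite /lebesgue_rV_step /pushforward -comp_preimage.
rewrite (_ : _ \o _ = id); last by apply/funext => p /=; rewrite rV_consK.
by rewrite preimage_id product_measure1E// lte_mul_pinfty// ge0_fin_numE.
Qed.

HB.instance Definition _ := Measure_isSigmaFinite.Build _ _ _
  lebesgue_rV_step step_sigma_finite.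

End lebesgue_rV_step.

(* Borel Lebesgue measure on R^d as an iterated product; it is pinned down by
   its value on boxes, see lebesgue_rV_box. *)
Fixpoint lebesgue_rV (R : realType) (d : nat) :
    {sigma_finite_measure set 'rV[R]_d -> \bar R} :=
  match d with
  | 0 => \d_(0 : 'rV[R]_0)
  | n.+1 => lebesgue_rV_step (lebesgue_rV R n)
  end.

(* R[i] with its modulus topology, as a normed module over itself. *)
HB.instance Definition _ (R : realType) := NormedModule.copy R[i] R[i]^o.

Definition cabs (R : realType) (z : R[i]) : R := complex.Re `|z|.

Section cabs.
Variable R : realType.
Implicit Types z : R[i].

Lemma cabsE z : `|z| = (cabs z)%:C.
Proof. by rewrite /cabs normc_def. Qed.

Lemma cabs_sqrt z : cabs z = Num.sqrt (complex.Re z ^+ 2 + complex.Im z ^+ 2).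
Proof. by rewrite /cabs normc_def. Qed.

Lemma cabs_ge0 z : 0 <= cabs z.
Proof. by rewrite cabs_sqrt sqrtr_ge0. Qed.

Lemma cabs0 : cabs (0 : R[i]) = 0.
Proof. by rewrite /cabs normr0. Qed.

Lemma cabs_eq0 z : cabs z = 0 -> z = 0.
Proof. by move=> z0; apply/normr0_eq0; rewrite cabsE z0. Qed.

Lemma cabsD z1 z2 : cabs (z1 + z2) <= cabs z1 + cabs z2.
Proof. by rewrite -lecR rmorphD/= -!cabsE ler_normD. Qed.

Lemma cabsM z1 z2 : cabs (z1 * z2) = cabs z1 * cabs z2.
Proof. by apply: complexI; rewrite rmorphM/= -!cabsE normrM. Qed.

End cabs.

Section complex_measurability.
Context dT (T : measurableType dT) (R : realType).

Definition cmeasurable (f : T -> R[i]) :=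
  measurable_fun [set: T] (fun x => complex.Re (f x)) /\
  measurable_fun [set: T] (fun x => complex.Im (f x)).

Lemma cmeasurableD f g :
  cmeasurable f -> cmeasurable g -> cmeasurable (f \+ g).
Proof.
move=> [mf1 mf2] [mg1 mg2]; split.
  rewrite (_ : (fun _ => _) = (fun x => complex.Re (f x) + complex.Re (g x))).
    exact: measurable_funD.
  by apply/funext => x /=; case: (f x) (g x) => [a b] [c d].
rewrite (_ : (fun _ => _) = (fun x => complex.Im (f x) + complex.Im (g x))).
  exact: measurable_funD.
by apply/funext => x /=; case: (f x) (g x) => [a b] [c d].
Qed.

Lemma cmeasurableM f g :
  cmeasurable f -> cmeasurable g -> cmeasurable (f \* g).
Proof.
move=> [mf1 mf2] [mg1 mg2]; split.
  rewrite (_ : (fun _ => _) = (fun x => complex.Re (f x) * complex.Re (g x) -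
                                   complex.Im (f x) * complex.Im (g x))).
    by apply: measurable_funB; exact: measurable_funM.
  by apply/funext => x /=; case: (f x) (g x) => [a b] [c d].
rewrite (_ : (fun _ => _) = (fun x => complex.Re (f x) * complex.Im (g x) +
                                 complex.Im (f x) * complex.Re (g x))).
  by apply: measurable_funD; exact: measurable_funM.
by apply/funext => x /=; case: (f x) (g x) => [a b] [c d].
Qed.

Lemma cmeasurable_cst c : cmeasurable (cst c).
Proof. by split; exact: measurable_cst. Qed.

Lemma measurable_cabs f :
  cmeasurable f -> measurable_fun [set: T] (fun x => cabs (f x)).
Proof.
move=> [mf1 mf2]; under eq_fun do rewrite cabs_sqrt.
have ms : measurable_fun [set: R] (@Num.sqrt R).
  apply: continuous_measurable_fun; exact: sqrt_continuous.
apply: (measurableT_comp ms).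
by apply: measurable_funD; exact: measurable_funX.
Qed.

End complex_measurability.

Section sqintegrable.
Context dT (T : measurableType dT) (R : realType).
Variable mu : {measure set T -> \bar R}.

Definition L2norm (f : T -> R[i]) : R :=
  fine ('N[mu]_2%:E[EFin \o (fun x => cabs (f x))])%E.

Definition sqintegrable : {pred T -> R[i]} := fun f =>
  `[< cmeasurable f /\ finite_norm mu 2%:E (fun x => cabs (f x)) >].

Let le_Lnorm2 (f g : T -> R) :
    measurable_fun setT f -> measurable_fun setT g ->
    (forall x, `|f x| <= `|g x|) ->
  ('N[mu]_2%:E[EFin \o f] <= 'N[mu]_2%:E[EFin \o g])%E.
Proof.
move=> mf mg fg; rewrite unlock/=; apply: gt0_ler_poweR => //.
- by rewrite in_itv/= leey andbT; apply: integral_ge0 => x _; rewrite lee_fin powR_ge0.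
- by rewrite in_itv/= leey andbT; apply: integral_ge0 => x _; rewrite lee_fin powR_ge0.
apply: ge0_le_integral => //.
- apply/measurable_EFinP.
  apply: (@measurableT_comp _ _ _ _ _ _ (fun x : R => x `^ 2)%R) => //.
  exact: measurableT_comp.
- apply/measurable_EFinP.
  apply: (@measurableT_comp _ _ _ _ _ _ (fun x : R => x `^ 2)%R) => //.
  exact: measurableT_comp.
- by move=> x _ /=; rewrite lee_fin ge0_ler_powR// ?nnegrE.
Qed.

Let L2normD_le (f g : T -> R[i]) : cmeasurable f -> cmeasurable g ->
  ('N[mu]_2%:E[EFin \o (fun x => cabs (f x + g x)%R)] <=
   'N[mu]_2%:E[EFin \o (fun x => cabs (f x))] +
   'N[mu]_2%:E[EFin \o (fun x => cabs (g x))])%E.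
Proof.
move=> mf mg.
have mcf := measurable_cabs mf; have mcg := measurable_cabs mg.
apply: le_trans (eminkowski mu mcf mcg _); last by rewrite lee_fin ler1n.
apply: le_Lnorm2.
- exact/measurable_cabs/cmeasurableD.
- exact: measurable_funD.
- move=> x; rewrite !ger0_norm ?cabs_ge0//; first exact: cabsD.
  by rewrite addr_ge0 ?cabs_ge0.
Qed.

Let L2normZ_eq a (f : T -> R[i]) : cmeasurable f ->
  ('N[mu]_2%:E[EFin \o (fun x => cabs (a * f x)%R)] =
   (cabs a)%:E * 'N[mu]_2%:E[EFin \o (fun x => cabs (f x))])%E.
Proof.
move=> mf; rewrite unlock/=.
under eq_integral do rewrite cabsM normrM powRM// EFinM.
rewrite ge0_integralZl//; last first.
  apply/measurable_EFinP.
  apply: (@measurableT_comp _ _ _ _ _ _ (fun x : R => x `^ 2)%R) => //.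
  by apply: measurableT_comp => //; exact: measurable_cabs.
rewrite poweRM ?lee_fin ?powR_ge0 ?integral_ge0//.
by rewrite poweR_EFin -powRrM mulfV// powRr1// ger0_norm// cabs_ge0.
Qed.

Lemma sqintegrable_submod_closed : submod_closed sqintegrable.
Proof.
split=> [|a f g /asboolP[mf ff] /asboolP[mg fg]]; apply/asboolP; split.
- exact: (cmeasurable_cst _ 0).
- rewrite /finite_norm (_ : _ \o _ = cst 0)%E.
    by rewrite Lnorm0// eqe pnatr_eq0.
  by apply/funext => x /=; rewrite cabs0.
- by apply: cmeasurableD => //; apply: (cmeasurableM (cmeasurable_cst _ a)).
- have maf : cmeasurable (fun x => a * f x).
    exact: (cmeasurableM (cmeasurable_cst _ a)).
  rewrite /finite_norm (le_lt_trans (L2normD_le maf mg))//.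
  by rewrite lte_add_pinfty// L2normZ_eq// lte_mul_pinfty// lee_fin cabs_ge0.
Qed.

HB.instance Definition _ :=
  GRing.isSubmodClosed.Build _ _ sqintegrable sqintegrable_submod_closed.

Record L2fun := L2Fun {
  L2fun_val :> T -> R[i] ;
  L2fun_sqintegrable : L2fun_val \in sqintegrable }.

HB.instance Definition _ := [isSub for L2fun_val].
HB.instance Definition _ := [Choice of L2fun by <:].
HB.instance Definition _ := [SubChoice_isSubLmodule of L2fun by <:].

Lemma L2norm_fin (f : L2fun) :
  (L2norm f)%:E = ('N[mu]_2%:E[EFin \o (fun x => cabs (f x))])%E.
Proof.
have /asboolP[_ fi] := L2fun_sqintegrable f.
by rewrite /L2norm fineK// ge0_fin_numE// Lnorm_ge0.
Qed.

Lemma L2norm_ge0 f : 0 <= L2norm f.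
Proof. by rewrite /L2norm fine_ge0// Lnorm_ge0. Qed.

Lemma ler_L2normD (f g : L2fun) : L2norm (f + g) <= L2norm f + L2norm g.
Proof.
rewrite -lee_fin EFinD !L2norm_fin.
have /asboolP[mf _] := L2fun_sqintegrable f.
have /asboolP[mg _] := L2fun_sqintegrable g.
exact: L2normD_le.
Qed.

Lemma L2normZ (a : R[i]) (f : L2fun) : L2norm (a *: f) = cabs a * L2norm f.
Proof.
apply: EFin_inj; rewrite EFinM !L2norm_fin.
have /asboolP[mf _] := L2fun_sqintegrable f.
exact: L2normZ_eq.
Qed.

Lemma L2norm_eq0 (f : L2fun) :
  L2norm f = 0 <-> {ae mu, forall x, f x = 0}.
Proof.
have /asboolP[mf _] := L2fun_sqintegrable f.
have mcf := measurable_cabs mf; split.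
  move=> /(congr1 (@EFin R)); rewrite L2norm_fin => /Lnorm_eq0_eq0.
  move=> /(_ _)/wrap[]; first exact/measurable_EFinP.
  move=> /(_ _)/wrap[]; first by rewrite lte_fin.
  by apply: filterS => x /(_ I) /= [] /cabs_eq0.
move=> f0; apply: EFin_inj; rewrite L2norm_fin.
rewrite unlock/= (ae_eq_integral (cst 0%E))//=; first last.
- apply: filterS f0 => x -> _ /=; rewrite cabs0 normr0 powR0//.
- apply/measurable_EFinP.
  apply: (@measurableT_comp _ _ _ _ _ _ (fun x : R => x `^ 2)%R) => //.
  exact: measurableT_comp.
by rewrite integral0 poweR0r.
Qed.

Definition L2null : {pred L2fun} := fun f => `[< {ae mu, forall x, f x = 0} >].

Lemma L2null_zmod_closed : zmod_closed L2null.
Proof.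
split; first by apply/asboolP; apply: nearW.
move=> f g /asboolP f0 /asboolP g0; apply/asboolP.
by apply: filterS2 f0 g0 => x /= fx gx; rewrite -[LHS]/(f x - g x) fx gx subr0.
Qed.

HB.instance Definition _ := GRing.isZmodClosed.Build _ L2null L2null_zmod_closed.

End sqintegrable.

Section L2.
Context dT (T : measurableType dT) (R : realType).
Variable mu : {measure set T -> \bar R}.
Local Open Scope quotient_scope.

(* Complex L^2(mu): square-integrable functions modulo a.e. equality.  Borel
   representatives lose nothing, as every Lebesgue measurable function is a.e.
   equal to a Borel one. *)
Definition L2 : Type := Quotient.quot (@L2null _ T R mu).
HB.instance Definition _ := Choice.on L2.
HB.instance Definition _ := EqQuotient.on L2.
HB.instance Definition _ := GRing.Zmodule.on L2.

Definition L2repr (f : L2) : T -> R[i] := (repr f : L2fun mu).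

Lemma L2piP (f g : L2fun mu) :
  \pi_L2 f = \pi_L2 g <-> {ae mu, forall x, f x = g x}.
Proof.
split=> [/eqP|fg].
  rewrite -Quotient.idealrBE => /asboolP; apply: filterS => x fgx.
  by apply/subr0_eq.
apply/eqP; rewrite -Quotient.idealrBE; apply/asboolP.
by apply: filterS fg => x fgx; rewrite -[LHS]/(f x - g x) fgx subrr.
Qed.

Lemma L2repr_pi (f : L2fun mu) : {ae mu, forall x, L2repr (\pi_L2 f) x = f x}.
Proof. by apply/L2piP; rewrite reprK. Qed.

Lemma L2piD (f g : L2fun mu) : \pi_L2 (f + g) = \pi_L2 f + \pi_L2 g.
Proof. exact: Quotient.pi_add. Qed.

Definition L2scale (a : R[i]) (f : L2) : L2 := \pi_L2 (a *: repr f).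

Lemma L2scale_pi a (f : L2fun mu) : L2scale a (\pi_L2 f) = \pi_L2 (a *: f).
Proof.
apply/L2piP; have := L2repr_pi f; apply: filterS => x fx.
by rewrite -[LHS]/(a * L2repr (\pi_L2 f) x) fx.
Qed.

Let L2scaleA a b f : L2scale a (L2scale b f) = L2scale (a * b) f.
Proof.
rewrite [L2scale b f]/L2scale L2scale_pi; rewrite /L2scale.
by rewrite scalerA.
Qed.

Let L2scale1 : left_id 1 L2scale.
Proof. by move=> f; rewrite /L2scale scale1r reprK. Qed.

Let L2scaleDr : right_distributive L2scale +%R.
Proof.
move=> a f g; rewrite -[f in LHS]reprK -[g in LHS]reprK -L2piD L2scale_pi.
by rewrite scalerDr L2piD.
Qed.

Let L2scaleDl f : {morph L2scale^~ f : a b / a + b}.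
Proof. by move=> a b; rewrite /L2scale scalerDl L2piD. Qed.

HB.instance Definition _ := GRing.Zmodule_isLmodule.Build R[i] L2
  L2scaleA L2scale1 L2scaleDr L2scaleDl.

Lemma L2norm_ae (f g : L2fun mu) :
  {ae mu, forall x, f x = g x} -> L2norm mu f = L2norm mu g.
Proof.
have [/asboolP[mf _] /asboolP[mg _]] :=
  (L2fun_sqintegrable f, L2fun_sqintegrable g).
move=> fg; rewrite /L2norm unlock/=; congr (fine (_ `^ _)%E).
apply: ae_eq_integral => //.
- apply/measurable_EFinP.
  apply: (@measurableT_comp _ _ _ _ _ _ (fun x : R => x `^ 2)%R) => //.
  by apply: measurableT_comp => //; exact: measurable_cabs.
- apply/measurable_EFinP.
  apply: (@measurableT_comp _ _ _ _ _ _ (fun x : R => x `^ 2)%R) => //.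
  by apply: measurableT_comp => //; exact: measurable_cabs.
- by apply: filterS fg => x -> _.
Qed.

Let nrm (f : L2) : R[i] := (L2norm mu (L2repr f))%:C.

Let nrm_pi (f : L2fun mu) : nrm (\pi_L2 f) = (L2norm mu f)%:C.
Proof. by congr (_%:C); apply/L2norm_ae/L2repr_pi. Qed.

Let nrmD f g : nrm (f + g) <= nrm f + nrm g.
Proof.
rewrite -[f]reprK -[g]reprK -L2piD !nrm_pi -rmorphD/= lecR.
exact: ler_L2normD.
Qed.

Let nrmZ a f : nrm (a *: f) = `|a| * nrm f.
Proof.
rewrite -[f]reprK -[a *: _]/(L2scale a _) L2scale_pi !nrm_pi.
by rewrite cabsE -rmorphM/= L2normZ.
Qed.

Let nrm_eq0 f : nrm f = 0 -> f = 0.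
Proof.
rewrite -[f]reprK nrm_pi => /complexI /L2norm_eq0 f0.
have -> : (0 : L2) = \pi_L2 0 by rewrite -[RHS]/(\pi_(Quotient.quot (@L2null _ T R mu)) 0) raddf0.
exact/L2piP.
Qed.

HB.instance Definition _ := Lmodule_isNormed.Build R[i] L2 nrmD nrmZ nrm_eq0.

Lemma L2_normE (f : L2) : `|f| = (L2norm mu (L2repr f))%:C.
Proof. by []. Qed.
End L2.

Section lebesgue_rV_theory.
Variable R : realType.

Lemma lebesgue_rVS d (A : set R) (B : set 'rV[R]_d) :
  measurable A -> measurable B ->
  lebesgue_rV R d.+1 [set x | A (x ord0 ord0) /\ B (\row_i x ord0 (lift ord0 i))] =
  (lebesgue_measure A * lebesgue_rV R d B)%E.
Proof.
move=> mA mB; rewrite -product_measure1E//=.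
rewrite /lebesgue_rV_step /pushforward; congr product_measure1.
by apply/seteqP; split=> -[a x] /=;
  rewrite rV_cons0 (_ : \row_i _ = x)//; apply/rowP => i; rewrite mxE rV_consS.
Qed.

Lemma lebesgue_rV_box d (a b : 'rV[R]_d) : (forall i, a ord0 i <= b ord0 i) ->
  lebesgue_rV R d [set x | forall i, a ord0 i < x ord0 i <= b ord0 i] =
  (\prod_(i < d) (b ord0 i - a ord0 i))%:E.
Proof.
elim: d a b => [|d IHd] a b ab.
  rewrite big_ord0 /= diracE mem_set//= => -[]//.
pose tl (x : 'rV[R]_d.+1) := \row_i x ord0 (lift ord0 i).
have mB : measurable [set x : 'rV[R]_d | forall i, tl a ord0 i < x ord0 i <= tl b ord0 i].
  rewrite (_ : [set _ | _] =
     \bigcap_(i in setT) [set x : 'rV[R]_d | x ord0 i \in `]tl a ord0 i, tl b ord0 i]]).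
    apply: fin_bigcap_measurable => [|i _]; first exact: finite_finset.
    have := @measurable_coord R d i measurableT `]tl a ord0 i, tl b ord0 i]%classic.
    by rewrite setTI; apply; exact: measurable_itv.
  apply/seteqP; split => x /= xab i.
    by move=> _; rewrite /= in_itv/=; exact: xab.
  by have := xab i I; rewrite /= in_itv.
rewrite big_ord_recl EFinM.
have -> : (b ord0 ord0 - a ord0 ord0)%:E =
    lebesgue_measure `]a ord0 ord0, b ord0 ord0]%classic.
  rewrite lebesgue_measure_itv/= lte_fin; case: ltP => [_|ba].
    by rewrite EFinB.
  by rewrite (@le_anti _ _ (b ord0 ord0) (a ord0 ord0)) ?ba ?ab// subrr.
have -> : (\prod_(i < d) (b ord0 (lift ord0 i) - a ord0 (lift ord0 i)))%:E =
    lebesgue_rV R d [set x | forall i, tl a ord0 i < x ord0 i <= tl b ord0 i].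
  rewrite IHd => [|i]; last by rewrite !mxE.
  by congr EFin; apply: eq_bigr => i _; rewrite !mxE.
rewrite -lebesgue_rVS//; congr (lebesgue_rV R d.+1 _).
apply/seteqP; split => x /=.
  move=> xab; split; first by rewrite in_itv/= xab.
  by move=> i; rewrite !mxE.
move=> [xab0 xabS] i; have [j ->|->] := unliftP ord0 i.
  by have := xabS j; rewrite !mxE.
by move: xab0; rewrite in_itv.
Qed.

Lemma lebesgue_measure_shift (a : R) (A : set R) : measurable A ->
  lebesgue_measure [set x | A (x + a)] = lebesgue_measure A.
Proof.
move=> mA.
have ma : measurable_fun [set: R] (fun x : R => x + a).
  by apply: measurable_funD => //; exact: measurable_cst.
pose P := measure_function_pushforward__canonical__measure_function_Measure
  (@lebesgue_measure R) (ma : @measurable_fun _ _ (measurableTypeR R) (measurableTypeR R) setT _).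
rewrite -[LHS]/(P A); apply/esym/lebesgue_measure_unique => //.
move=> _ [[b c] _ <-] /=; rewrite /pushforward/=.
rewrite (_ : _ @^-1` _ = `]b - a, c - a]%classic); last first.
  by apply/seteqP; split => x/=; rewrite !in_itv/= ltrBlDr lerBrDr.
by rewrite !lebesgue_measure_itv/= !lte_fin ltrD2r -!EFinB opprB addrA subrK.
Qed.

Lemma measurable_shift d (a : 'rV[R]_d) :
  measurable_fun [set: 'rV[R]_d] (fun x : 'rV[R]_d => x + a).
Proof.
apply/measurable_fun_rVP => i; under eq_fun do rewrite mxE.
by apply: measurable_funD => //; exact: measurable_coord.
Qed.

Lemma lebesgue_rV_shift d (a : 'rV[R]_d) (A : set 'rV[R]_d) : measurable A ->
  lebesgue_rV R d [set x | A (x + a)] = lebesgue_rV R d A.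
Proof.
elim: d a A => [|d IHd] a A mA.
  by congr (lebesgue_rV R 0 _); apply/seteqP; split => x /=;
    rewrite (_ : x + a = x)//; apply/rowP => -[].
pose a0 := a ord0 ord0; pose a' : 'rV[R]_d := \row_i a ord0 (lift ord0 i).
pose h (x : measurableTypeR R * 'rV[R]_d) : measurableTypeR R * 'rV[R]_d :=
  (x.1 + a0, x.2 + a').
have mh : measurable_fun setT h.
  apply: measurable_fun_pair.
    apply: (@measurable_funD _ _ R setT fst (cst a0)) => //.
  by apply: (measurableT_comp (measurable_shift a')).
pose P := measure_function_pushforward__canonical__measure_function_Measure
  (@lebesgue_measure R \x lebesgue_rV R d)%E mh.
have mA' : measurable (@rV_cons R d @^-1` A).
  by rewrite -[X in measurable X]setTI; exact: measurable_rV_cons.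
rewrite /= /lebesgue_rV_step /pushforward/=.
have PE B C : measurable B -> measurable C ->
  P (B `*` C) = (lebesgue_measure B * lebesgue_rV R d C)%E.
  move=> mB mC.
  rewrite -[LHS]/((lebesgue_measure \x lebesgue_rV R d)%E
    ([set x | B (x + a0)] `*` [set x | C (x + a')])).
  have mB' : measurable [set x : R | B (x + a0)].
    have ma : measurable_fun [set: R] (fun x : R => x + a0).
      by apply: measurable_funD => //; exact: measurable_cst.
    by have := ma measurableT B mB; rewrite setTI.
  have mC' : measurable [set x : 'rV[R]_d | C (x + a')].
    by have := measurable_shift a' measurableT mC; rewrite setTI.
  rewrite product_measure1E//; congr (_ * _)%E; last exact: IHd.
  exact: lebesgue_measure_shift.
rewrite [RHS](product_measure_unique PE)//=.
rewrite /pushforward; congr product_measure1.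
apply/seteqP; split => -[x y] /=; rewrite (_ : rV_cons (x, y) + a = rV_cons (h (x, y)))//;
  apply/rowP => i; have [j ->|->] := unliftP ord0 i;
  by rewrite mxE ?rV_consS ?rV_cons0//= mxE mxE.
Qed.

End lebesgue_rV_theory.

Section L2_dot.
Context dT (T : measurableType dT) (R : realType).
Variable mu : {measure set T -> \bar R}.

Definition cintegral (f : T -> R[i]) : R[i] :=
  (\int[mu]_x complex.Re (f x)) +i* (\int[mu]_x complex.Im (f x)).

Definition L2dot (f g : L2 mu) : R[i] :=
  cintegral (fun x => L2repr f x * (L2repr g x)^*).

(* The class of f; it is 0 when f is not square-integrable, a case that does not
   occur below, see tfshift_fun_sqintegrable. *)
Definition toL2 (f : T -> R[i]) : L2 mu :=
  \pi_(L2 mu)%qT (insubd (0 : L2fun mu) f).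

Lemma toL2E (f : T -> R[i]) : f \in sqintegrable mu ->
  {ae mu, forall x, L2repr (toL2 f) x = f x}.
Proof.
move=> fi; have := L2repr_pi (insubd (0 : L2fun mu) f).
by apply: filterS => x ->; rewrite insubdK.
Qed.

(* For a bounded linear A, Riesz representation gives a unique such h. *)
Definition adjoint (A : L2 mu -> L2 mu) (g : L2 mu) : L2 mu :=
  xget 0 [set h | forall f, L2dot (A f) g = L2dot f h].

End L2_dot.

Section compact_weak.
Variables (K : numFieldType) (V : normedModType K).

(* Linearity is required separately, by taking S : {linear V -> V}. *)
Definition compact_operator (S : V -> V) : Prop :=
  forall B : set V, bounded_set B -> precompact (S @` B).

Definition weakly_cvg (u : nat -> V) (f : V) : Prop :=
  forall phi : {scalar V}, continuous (phi : V -> K) ->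
    phi (u n) @[n --> \oo] --> phi f.

End compact_weak.

Section cohen.
Variables (R : realType) (d : nat).

Local Notation leb := (lebesgue_rV R d).

Definition expi (t : R) : R[i] := cos t +i* sin t.

Lemma cabs_expi t : cabs (expi t) = 1.
Proof. by rewrite cabs_sqrt/= cos2Dsin2 sqrtr1. Qed.

Definition tfshift_fun (z : 'rV[R]_d * 'rV[R]_d) (f : 'rV[R]_d -> R[i]) :=
  fun y : 'rV[R]_d =>
    expi (2 * pi * \sum_(i < d) z.2 ord0 i * y ord0 i) * f (y - z.1).

Lemma tfshift_fun_sqintegrable z f :
  f \in sqintegrable leb -> tfshift_fun z f \in sqintegrable leb.
Proof.
move=> /asboolP[[mf1 mf2] fi]; apply/asboolP.
have ms := measurable_shift (- z.1).
have mfs : cmeasurable (fun y : 'rV[R]_d => f (y - z.1)).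
  by split; [exact: (measurableT_comp mf1)|exact: (measurableT_comp mf2)].
split.
  apply: cmeasurableM => //.
  have mt : measurable_fun setT (fun y : 'rV[R]_d =>
      2 * pi * \sum_(i < d) z.2 ord0 i * y ord0 i).
    apply: measurable_funM => //; apply: measurable_sum => i.
    by apply: measurable_funM => //; exact: measurable_coord.
  split; apply: measurableT_comp mt => //; apply: continuous_measurable_fun.
  - exact: continuous_cos.
  - exact: continuous_sin.
apply: le_lt_trans fi; rewrite le_eqVlt; apply/orP; left; apply/eqP.
rewrite unlock/=; congr (_ `^ _)%E.
under eq_integral do rewrite cabsM cabs_expi mul1r.
have mcf : measurable_fun setT (fun y : 'rV[R]_d => (`|cabs (f y)| `^ 2)%:E).
  apply/measurable_EFinP.
  apply: (@measurableT_comp _ _ _ _ _ _ (fun x : R => x `^ 2)%R) => //.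
  by apply: measurableT_comp => //; exact: measurable_cabs.
have /= <- := @ge0_integral_pushforward _ _ _ _ R _ ms leb setT _ measurableT mcf.
  apply: eq_measure_integral => A mA _.
  exact: lebesgue_rV_shift.
by move=> y _; rewrite lee_fin powR_ge0.
Qed.

Definition tfshift (z : 'rV[R]_d * 'rV[R]_d) (f : L2 leb) : L2 leb :=
  toL2 leb (tfshift_fun z (L2repr f)).

Lemma tfshiftE z (f : L2 leb) :
  {ae leb, forall y, L2repr (tfshift z f) y = tfshift_fun z (L2repr f) y}.
Proof. by apply: toL2E; apply: tfshift_fun_sqintegrable; exact: L2fun_sqintegrable. Qed.

Definition opshift (z : 'rV[R]_d * 'rV[R]_d) (S : L2 leb -> L2 leb) :
    L2 leb -> L2 leb :=
  tfshift z \o S \o adjoint (tfshift z).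

Definition cohen (S : L2 leb -> L2 leb) (f : L2 leb)
    (z : 'rV[R]_d * 'rV[R]_d) : R[i] :=
  L2dot (opshift z S f) f.

(* R^{2d} is the set of pairs (x, xi) with the complete Lebesgue measure, so that
   measurable sets of phase_space are exactly the Lebesgue measurable ones. *)
Definition phase_space : measurableType _ :=
  caratheodory_type ((leb \x leb)%E^*)%mu.

Definition phase_measure : {measure set phase_space -> \bar R} :=
  @completed_measure_extension _ _ R (leb \x leb)%E.

(* J_S, which is also the L^p(Omega) norm of Q_S f; it is extended-real valued so
   that its finiteness is not built into the definition. *)
Definition concentration (p : R) (Omega : set phase_space)
    (S : L2 leb -> L2 leb) (f : L2 leb) : \bar R :=
  ((\int[phase_measure]_(z in Omega) (cabs (cohen S f z) `^ p)%:E) `^ p^-1)%E.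

Definition concentration_ratio (p : R) (Omega : set phase_space)
    (S : L2 leb -> L2 leb) (f : L2 leb) : \bar R :=
  (concentration p Omega S f * (complex.Re `|f| ^- 2)%:E)%E.

Definition Lambda (p : R) (Omega : set phase_space)
    (S : L2 leb -> L2 leb) : \bar R :=
  ereal_sup [set concentration_ratio p Omega S f | f in [set f | f != 0]].

End cohen.

Notation L2_rV R d := (L2 (lebesgue_rV R d)).

(* Main.v *)
Require Import Defs.
From HB Require Import structures.
From mathcomp Require Import all_boot all_order all_algebra.
From mathcomp Require Import all_classical all_reals all_analysis.
From mathcomp Require Import measurable_realfun complex ring lra.
Import Order.TTheory GRing.Theory Num.Theory.
Import numFieldNormedType.Exports.
Local Open Scope classical_set_scope.
Local Open Scope ring_scope.

Set Implicit Arguments.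
Unset Strict Implicit.
Unset Printing Implicit Defensive.

(* Since alpha_z(S) = pi(z) S pi(z)^*, one has Q_S f(z) = <S g, g> with
   g = pi(z)^* f.  If u_n converges weakly to f, then (u_n) is bounded and
   pi(z)^* u_n converges weakly to pi(z)^* f, hence strongly after applying the
   compact operator S; so Q_S u_n(z) --> Q_S f(z) for every z, and dominated
   convergence on Omega gives J_S(u_n) --> J_S(f).  As J_S is quadratically
   homogeneous, the supremum may be taken over unit vectors; a maximizing
   sequence has a subsequence with a weak limit f, J_S(f) = Lambda, and
   J_S(f) <= Lambda |f|^2 with |f| <= 1 and Lambda > 0 forces |f| = 1, whence
   strong convergence.  If Lambda = 0, polarization along a countable total
   family, together with |Omega| > 0, yields a single z at which the form
   <S pi(z)^* ., pi(z)^* .> vanishes, so that S = 0.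

   The function z |-> Q_S f(z) is measurable because, by Fubini,
   z |-> <h, pi(z)^* f> is so for every h, and because norms in a separable
   space are countable suprema of such functions. *)

(** [adjoint] is a choice among the vectors satisfying an identity, so nothing can be said about
    [cohen] until Riesz representation shows that such a vector exists; this is what completeness of
    L2 is for. Projection, Riesz and boundedness arguments use the real form [rdot], where order and
    minimisation make sense; the complex form is recovered by rotating one argument by i. Bounds
    obtained from real and imaginary parts separately pick up a factor 2, harmless because only
    finiteness is at stake. One countable total sequence, made from indicators of rational boxes,
    serves three times: to turn an ultrafilter limit into a limit along a subsequence, to write a
    squared norm as a countable supremum, and to keep the exceptional null sets countable in number
    when [Lambda] vanishes. Fubini lives on the product sigma-algebra while [Omega] is only Lebesgue
    measurable; measurability is therefore proved on the product and then transferred to the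
    completed phase space. *)

Section complex_extra.
Variable R : realType.
Implicit Types z w : R[i].

Lemma cReD z w : complex.Re (z + w) = complex.Re z + complex.Re w.
Proof. by case: z w => [a b] [c d]. Qed.

Lemma cImD z w : complex.Im (z + w) = complex.Im z + complex.Im w.
Proof. by case: z w => [a b] [c d]. Qed.

Lemma cReN z : complex.Re (- z) = - complex.Re z.
Proof. by case: z. Qed.

Lemma cImN z : complex.Im (- z) = - complex.Im z.
Proof. by case: z. Qed.

Lemma cReM z w :
  complex.Re (z * w) = complex.Re z * complex.Re w - complex.Im z * complex.Im w.
Proof. by case: z w => [a b] [c d]. Qed.

Lemma cImM z w :
  complex.Im (z * w) = complex.Re z * complex.Im w + complex.Im z * complex.Re w.
Proof. by case: z w => [a b] [c d]. Qed.

Lemma cReC (r : R) : complex.Re (r%:C)%C = r. Proof. by []. Qed.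
Lemma cImC (r : R) : complex.Im (r%:C)%C = 0. Proof. by []. Qed.

Lemma cReJ z : complex.Re z^* = complex.Re z. Proof. by case: z. Qed.
Lemma cImJ z : complex.Im z^* = - complex.Im z. Proof. by case: z. Qed.

Lemma complex_ext z w :
  complex.Re z = complex.Re w -> complex.Im z = complex.Im w -> z = w.
Proof. by case: z w => [a b] [c d] /= -> ->. Qed.

Lemma cabs_ge_Re z : `|complex.Re z| <= cabs z.
Proof.
rewrite cabs_sqrt -sqrtr_sqr ler_sqrt; last by rewrite addr_ge0 ?sqr_ge0.
by rewrite lerDl sqr_ge0.
Qed.

Lemma cabs_ge_Im z : `|complex.Im z| <= cabs z.
Proof.
rewrite cabs_sqrt -sqrtr_sqr ler_sqrt; last by rewrite addr_ge0 ?sqr_ge0.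
by rewrite lerDr sqr_ge0.
Qed.

Lemma cabs_le z : cabs z <= `|complex.Re z| + `|complex.Im z|.
Proof.
rewrite cabs_sqrt -[leRHS]ger0_norm ?addr_ge0// -sqrtr_sqr ler_sqrt ?sqr_ge0//.
rewrite sqrrD !real_normK ?num_real// -subr_ge0.
set A := _ ^+ 2; set B := _ ^+ 2; set C := _ *+ 2.
rewrite (_ : _ - _ = C); first by rewrite mulrn_wge0// mulr_ge0.
by ring.
Qed.

End complex_extra.

Lemma cvg0P (R : realType) (x : nat -> R) :
  x n @[n --> \oo] --> (0 : R) <->
  forall e, 0 < e -> exists N, forall n, (N <= n)%N -> `|x n| < e.
Proof.
split=> [/cvgrPdist_lt x0 e e0|x0].
  have [N _ xN] := x0 _ e0.
  by exists N => n /xN /=; rewrite sub0r normrN.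
apply/cvgrPdist_lt => e e0; have [N xN] := x0 _ e0.
by exists N => // n /xN /=; rewrite sub0r normrN.
Qed.

(** * Hilbert spaces *)

Section hilbert_def.
Variables (R : realType) (V : lmodType R[i]) (dot : V -> V -> R[i]).

Definition rdot f g := complex.Re (dot f g).
Definition hnorm f := Num.sqrt (rdot f f).

(** [V] carries no topology here, so completeness and all later limits are phrased through real
    sequences of values of [hnorm]. *)
Record is_hilbert : Prop := IsHilbert {
  dotDl : forall f g h, dot (f + g) h = dot f h + dot g h ;
  dotZl : forall a f h, dot (a *: f) h = a * dot f h ;
  dotJ : forall f g, dot g f = (dot f g)^* ;
  rdot_ge0 : forall f, 0 <= rdot f f ;
  rdot_eq0 : forall f, rdot f f = 0 -> f = 0 ;
  hilbert_complete : forall u : nat -> V,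
    (forall e, 0 < e -> exists N, forall m n, (N <= m)%N -> (N <= n)%N ->
      hnorm (u m - u n) < e) ->
    exists f, hnorm (u n - f) @[n --> \oo] --> (0 : R) }.

Definition wcvg (u : nat -> V) f :=
  forall h, rdot (u n) h @[n --> \oo] --> rdot f h.

(** Only real scalars are allowed: the sets of interest are defined by conditions on [rdot], such as
    the kernel of a real functional, and projection onto a real subspace is enough for them. *)
Definition closed_subspace (N : set V) :=
  [/\ N 0, forall (r : R) f g, N f -> N g -> N ((r%:C)%C *: f + g) &
    forall f, (forall e, 0 < e -> exists2 g, N g & hnorm (f - g) < e) -> N f].

(** Totality over the reals: a complex total family has to be enlarged by its multiples by i. *)
Definition total_seq (e : nat -> V) :=
  forall f, (forall k, rdot f (e k) = 0) -> f = 0.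

End hilbert_def.

Section hilbert_theory.
Variables (R : realType) (V : lmodType R[i]) (dot : V -> V -> R[i]).
Hypothesis H : is_hilbert dot.
Local Notation rd := (rdot dot).
Local Notation nrm := (hnorm dot).
Implicit Types (f g h : V) (r : R).

Lemma rdotC f g : rd f g = rd g f.
Proof. by rewrite /rdot (dotJ H f g) cReJ. Qed.

Lemma rdotDl f g h : rd (f + g) h = rd f h + rd g h.
Proof. by rewrite /rdot (dotDl H) cReD. Qed.

Lemma rdotZl r f h : rd ((r%:C)%C *: f) h = r * rd f h.
Proof. by rewrite /rdot (dotZl H) cReM cReC cImC mul0r subr0. Qed.

Lemma rdotNl f h : rd (- f) h = - rd f h.
Proof.
rewrite -scaleN1r (_ : -1 = ((-1 : R)%:C)%C); first by rewrite rdotZl mulN1r.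
by rewrite rmorphN rmorph1.
Qed.

Lemma rdotBl f g h : rd (f - g) h = rd f h - rd g h.
Proof. by rewrite rdotDl rdotNl. Qed.

Lemma rdotDr f g h : rd h (f + g) = rd h f + rd h g.
Proof. by rewrite rdotC rdotDl !(rdotC h). Qed.

Lemma rdotZr r f h : rd h ((r%:C)%C *: f) = r * rd h f.
Proof. by rewrite rdotC rdotZl !(rdotC h). Qed.

Lemma rdotNr f h : rd h (- f) = - rd h f.
Proof. by rewrite rdotC rdotNl !(rdotC h). Qed.

Lemma rdotBr f g h : rd h (f - g) = rd h f - rd h g.
Proof. by rewrite rdotDr rdotNr. Qed.

Lemma rdot0l h : rd 0 h = 0.
Proof. by rewrite -(subrr 0) rdotBl subrr. Qed.

Lemma rdot0r h : rd h 0 = 0.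
Proof. by rewrite rdotC rdot0l. Qed.

Lemma rdotE f g : dot f g = (rdot dot f g +i* - rdot dot ('i%C *: f) g)%C.
Proof.
apply: complex_ext => //=.
by rewrite /rdot (dotZl H) cReM /= mul0r mul1r sub0r opprK.
Qed.

Lemma nrm_ge0 f : 0 <= nrm f. Proof. exact: sqrtr_ge0. Qed.

Lemma nrm2 f : nrm f ^+ 2 = rd f f.
Proof. by rewrite sqr_sqrtr// (rdot_ge0 H). Qed.

Lemma nrm0 : nrm 0 = 0.
Proof. by rewrite /hnorm rdot0l sqrtr0. Qed.

Lemma nrm_eq0 f : nrm f = 0 -> f = 0.
Proof. by move=> f0; apply: (rdot_eq0 H); rewrite -nrm2 f0 expr0n. Qed.

Lemma nrmN f : nrm (- f) = nrm f.
Proof. by rewrite /hnorm rdotNl rdotNr opprK. Qed.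

Lemma nrmB f g : nrm (f - g) = nrm (g - f).
Proof. by rewrite -nrmN opprB. Qed.

Lemma nrmZ r f : nrm ((r%:C)%C *: f) = `|r| * nrm f.
Proof.
by rewrite /hnorm rdotZl rdotZr mulrA -expr2 sqrtrM ?sqr_ge0// sqrtr_sqr.
Qed.

Lemma nrm2D f g : nrm (f + g) ^+ 2 = nrm f ^+ 2 + 2 * rd f g + nrm g ^+ 2.
Proof. by rewrite !nrm2 rdotDl !rdotDr (rdotC g f); ring. Qed.

Lemma nrm2B f g : nrm (f - g) ^+ 2 = nrm f ^+ 2 - 2 * rd f g + nrm g ^+ 2.
Proof. by rewrite nrm2D nrmN rdotNr; ring. Qed.

Lemma rdot_le f g : `|rd f g| <= nrm f * nrm g.
Proof.
have [g0|g0] := eqVneq (nrm g) 0.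
  by rewrite (nrm_eq0 g0) rdot0r normr0 mulr_ge0// nrm_ge0.
rewrite -ler_sqr ?nnegrE ?mulr_ge0 ?nrm_ge0// real_normK ?num_real//.
(* The component of [f] orthogonal to [g] has nonnegative squared norm; multiplying by the squared
   norm of [g] gives Cauchy-Schwarz. *)
have := sqr_ge0 (nrm (f - ((rd f g / nrm g ^+ 2)%:C)%C *: g)).
rewrite nrm2B rdotZr nrmZ exprMn real_normK ?num_real//.
set a := nrm f; set b := nrm g; set c := rd f g => /(mulr_ge0 (sqr_ge0 b)).
rewrite -subr_ge0; congr (0 <= _); field.
exact: g0.
Qed.

Lemma nrmD f g : nrm (f + g) <= nrm f + nrm g.
Proof.
rewrite -ler_sqr ?nnegrE ?addr_ge0 ?nrm_ge0// nrm2D.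
have := le_trans (ler_norm _) (rdot_le f g); lra.
Qed.

Lemma nrm_triangle f g h : nrm (f - h) <= nrm (f - g) + nrm (g - h).
Proof. by rewrite -[f - h](_ : (f - g) + (g - h) = _) ?nrmD// addrA subrK. Qed.

Lemma nrm_leD f g : nrm f <= nrm (f - g) + nrm g.
Proof. by rewrite -{1}(subrK g f) nrmD. Qed.

Lemma nrmZi f : nrm ('i%C *: f) = nrm f.
Proof.
congr Num.sqrt; rewrite /rdot (dotZl H) (dotJ H ('i%C *: f)) (dotZl H).
rewrite cReM cReJ cImJ cReM cImM /=.
by ring.
Qed.

End hilbert_theory.

(** * Orthogonal projection, Riesz representation, uniform boundedness *)

Section hilbert_projection.
Variables (R : realType) (V : lmodType R[i]) (dot : V -> V -> R[i]).
Hypothesis H : is_hilbert dot.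
Local Notation rd := (rdot dot).
Local Notation nrm := (hnorm dot).
Implicit Types (f g h : V) (r : R) (N : set V).

Lemma nrm_cvg_lt (u : nat -> V) f : nrm (u n - f) @[n --> \oo] --> (0 : R) ->
  forall e, 0 < e -> exists M, forall n, (M <= n)%N -> nrm (u n - f) < e.
Proof.
move=> /cvg0P uf e e0; have [M uM] := uf _ e0.
by exists M => n /uM; rewrite ger0_norm// nrm_ge0.
Qed.

Lemma nrm_le_lim (u : nat -> V) f g (c : R) :
  nrm (u n - f) @[n --> \oo] --> (0 : R) ->
  (exists M, forall n, (M <= n)%N -> nrm (g - u n) <= c) -> nrm (g - f) <= c.
Proof.
move=> /nrm_cvg_lt uf [M uM]; apply/ler_addgt0Pr => e e0.
have [M' uM'] := uf _ e0.
have := uM _ (leq_maxl M M'); have := uM' _ (leq_maxr M M').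
have := nrm_triangle H g (u (maxn M M')) f; lra.
Qed.

Lemma projection N h : closed_subspace dot N ->
  exists2 n, N n & forall m, N m -> rd (h - n) m = 0.
Proof.
move=> [N0 NZD Ncl].
have Nd m k : N m -> N k -> N (m + k).
  by move=> Nm Nk; have := NZD 1 _ _ Nm Nk; rewrite rmorph1 scale1r.
have NZ r m : N m -> N ((r%:C)%C *: m).
  by move=> Nm; have := NZD r _ _ Nm N0; rewrite addr0.
pose A := [set nrm (h - m) ^+ 2 | m in N].
have A0 : A !=set0 by exists (nrm (h - 0) ^+ 2); exists 0.
have lbA : has_lbound A by exists 0 => _ [m _ <-]; rewrite sqr_ge0.
pose delta := inf A.
have deltaP m : N m -> delta <= nrm (h - m) ^+ 2.
  by move=> Nm; apply: ge_inf => //; exists m.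
have apx (k : nat) : exists m, N m /\ nrm (h - m) ^+ 2 < delta + k.+1%:R^-1.
  have : 0 < (k.+1%:R : R)^-1 by rewrite invr_gt0.
  move=> /(inf_adherent) /(_ (conj A0 lbA)) [_ [m Nm <-]] mlt.
  by exists m.
have [u uP] := choice apx.
(* Parallelogram law: the midpoint of [u m] and [u k] lies in [N], hence at squared distance at
   least [delta] from [h], which forces near-minimisers to be close to each other. *)
have close m k : nrm (u m - u k) ^+ 2 <= 2 * m.+1%:R^-1 + 2 * k.+1%:R^-1.
  have [Num um] := uP m; have [Nuk uk] := uP k.
  have := deltaP _ (NZ 2^-1 _ (Nd _ _ Num Nuk)).
  have : nrm ((h - u m) + (h - u k)) ^+ 2 =
      4 * nrm (h - ((2^-1 : R)%:C)%C *: (u m + u k)) ^+ 2.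
    rewrite (_ : _ + (h - u k) =
        (((2 : R)%:C)%C *: (h - ((2^-1 : R)%:C)%C *: (u m + u k)))).
      by rewrite nrmZ// exprMn normr_nat; ring.
    rewrite scalerBr scalerA -rmorphM/= mulfV// rmorph1 scale1r opprD addrACA.
    by rewrite (_ : (2%:C)%C = 1 + 1 :> R[i]) ?scalerDl ?scale1r// -(rmorphD _ (1:R) 1).
  have := nrm2B H (h - u m) (h - u k).
  rewrite (_ : _ - (h - u k) = u k - u m); last by rewrite opprB addrC subrKA.
  rewrite (nrmB H (u m)) (nrm2D H (h - u m)).
  move: um uk.
  move: (m.+1%:R^-1) (k.+1%:R^-1) => x y; lra.
have [e e0|n un] := hilbert_complete H (u := u).
  have [M Me] : exists M, forall m, (M <= m)%N -> (m.+1%:R : R)^-1 < e ^+ 2 / 4.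
    have e4 : 0 < e ^+ 2 / 4 by rewrite divr_gt0// exprn_gt0.
    have [M _ MP] := near_infty_natSinv_lt (PosNum e4).
    by exists M => m /MP.
  exists M => m k /Me mM /Me kM; rewrite -ltr_sqr ?nnegrE ?nrm_ge0 ?ltW//.
  apply: le_lt_trans (close m k) _.
  by move: (m.+1%:R^-1) (k.+1%:R^-1) mM kM => x y; lra.
have Nn : N n.
  apply: Ncl => e e0; have [M MP] := nrm_cvg_lt un e0.
  exists (u M); first by have [] := uP M.
  by rewrite nrmB// MP.
exists n => // m Nm.
have hn : nrm (h - n) ^+ 2 <= delta.
  apply/ler_addgt0Pr => e e0.
  have e'0 : 0 < delta + e.
    by rewrite ltr_wpDl// lb_le_inf// => _ [? _ <-]; rewrite sqr_ge0.
  rewrite -(sqr_sqrtr (ltW e'0)) ler_sqr ?nnegrE ?nrm_ge0 ?sqrtr_ge0//.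
  apply: (nrm_le_lim un).
  have [M _ MP] := near_infty_natSinv_lt (PosNum e0).
  exists M => k Mk0; have Mk : (k.+1%:R : R)^-1 < e := MP k Mk0.
  rewrite -[nrm _]ger0_norm ?nrm_ge0// -sqrtr_sqr ler_sqrt ?(ltW e'0)//.
  by have [_] := uP k; move: (k.+1%:R^-1) Mk => x; lra.
have quad t : 0 <= - (2 * t * rd (h - n) m) + t ^+ 2 * nrm m ^+ 2.
  have := deltaP _ (Nd _ _ Nn (NZ t _ Nm)).
  rewrite opprD addrA nrm2B// rdotZr// nrmZ// exprMn real_normK ?num_real//.
  lra.
move: (rd _ _) (nrm m ^+ 2) quad (sqr_ge0 (nrm m)) => a b quad b0.
(* The quadratic is minimal at [a / b]; the value [a / (b + 1)] is just as conclusive and also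
   covers [b = 0]. *)
have := quad (a / (b + 1)).
have b1 : b + 1 != 0 by rewrite gt_eqF // ltr_wpDl.
rewrite -(pmulr_rge0 _ (_ : 0 < (b + 1) ^+ 2)) ?exprn_gt0 ?ltr_wpDl//.
rewrite (_ : _ * _ = - (a ^+ 2 * (b + 2))); last by field.
rewrite oppr_ge0 => le0; apply/eqP; rewrite -sqrf_eq0 eq_le sqr_ge0 andbT.
by rewrite -(pmulr_lle0 _ (_ : 0 < b + 2))// ltr_wpDl.
Qed.
Lemma total_subspace (e : nat -> V) N : total_seq dot e ->
  closed_subspace dot N -> (forall k, N (e k)) -> forall h, N h.
Proof.
move=> tot Ncl Ne h; have [n Nn ort] := projection h Ncl.
have : h - n = 0 by apply: tot => k; apply: ort.
by move/subr0_eq => ->.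
Qed.

Lemma riesz_real (phi : V -> R) (C : R) :
  (forall r f g, phi ((r%:C)%C *: f + g) = r * phi f + phi g) ->
  (forall f, `|phi f| <= C * nrm f) ->
  exists h, forall f, phi f = rd f h.
Proof.
move=> lin bnd.
have phi0 : phi 0 = 0.
  by have := lin 1 0 0; rewrite rmorph1 scale1r addr0 mul1r; lra.
have phiZ r f : phi ((r%:C)%C *: f) = r * phi f.
  by have := lin r f 0; rewrite addr0 phi0 addr0.
have phiB f g : phi (f - g) = phi f - phi g.
  rewrite addrC -scaleN1r (_ : -1 = ((-1 : R)%:C)%C); last by rewrite rmorphN rmorph1.
  by rewrite lin; ring.
have ker_closed : closed_subspace dot [set f | phi f = 0].
  split=> //= [r f g pf pg|f cl]; first by rewrite lin pf pg mulr0 addr0.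
  apply/eqP; rewrite -normr_le0; apply/ler_addgt0Pr => e e0; rewrite add0r.
  have C0 : 0 < `|C| + 1 by rewrite ltr_wpDl.
  have [g pg fg] := cl _ (divr_gt0 e0 C0).
  have := bnd (f - g); rewrite phiB pg subr0 => /le_trans; apply.
  move: fg; rewrite ltr_pdivlMr// => /ltW; apply: le_trans.
  by rewrite mulrC ler_wpM2l ?nrm_ge0// (le_trans (ler_norm C))// lerDl.
have [allker|] := pselect (forall f, phi f = 0).
  by exists 0 => f; rewrite allker rdot0r.
move=> /existsNP[v /eqP pv].
have [n pn ort] := projection v ker_closed.
pose w := v - n; have pw : phi w = phi v by rewrite phiB pn subr0.
have w0 : rd w w != 0.
  apply: contra_neq pv => /(rdot_eq0 H) w0.
  by rewrite -pw w0.
exists (((phi v / rd w w)%:C)%C *: w) => f; rewrite rdotZr//.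
(* The subtracted multiple of [w] puts the difference into the kernel of [phi], to which [w] is
   orthogonal. *)
have : rd w (f - (((phi f / phi v)%:C)%C *: w)) = 0.
  by apply: ort => /=; rewrite phiB phiZ pw divfK ?subrr.
rewrite rdotBr// rdotZr// rdotC// => /subr0_eq ->.
by field; rewrite pv w0.
Qed.

(** A complex-linear functional is determined by its real part, its imaginary part at [f] being
    minus the real part at i times [f]; the vector representing the real part therefore represents
    [phi]. *)
Lemma riesz (phi : V -> R[i]) (C : R) :
  (forall a f g, phi (a *: f + g) = a * phi f + phi g) ->
  (forall f, cabs (phi f) <= C * nrm f) ->
  exists h, forall f, phi f = dot f h.
Proof.
move=> lin bnd.
have [||h hP] := riesz_real (phi := fun f => complex.Re (phi f)) (C := C).
- by move=> r f g; rewrite lin cReD cReM cReC cImC mul0r subr0.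
- by move=> f; apply: le_trans (bnd f); exact: cabs_ge_Re.
exists h => f; rewrite (rdotE H); apply: complex_ext => //=.
rewrite -hP; have phi0 : phi 0 = 0.
  have := lin 1 0 0; rewrite scale1r addr0 mul1r => /(congr1 (fun x => x - phi 0)).
  by rewrite subrr addrK.
by have := lin 'i%C f 0; rewrite phi0 !addr0 => ->; rewrite cReM/= mul0r mul1r sub0r opprK.
Qed.

Lemma adjoint_exists (A : V -> V) (C : R) :
  (forall a f g, A (a *: f + g) = a *: A f + A g) ->
  (forall f, nrm (A f) <= C * nrm f) ->
  forall g, exists h, forall f, dot (A f) g = dot f h.
Proof.
move=> lin bnd g.
apply: (@riesz (fun f => dot (A f) g) (2 * (C * nrm g))) => [a f f'|f].
  by rewrite lin (dotDl H) (dotZl H).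
have C0 : 0 <= C * nrm f by apply: le_trans (bnd f); exact: nrm_ge0.
apply: le_trans (cabs_le _) _; rewrite (rdotE H)/= normrN.
have le1 a : nrm a = nrm (A f) -> `|rd a g| <= C * nrm f * nrm g.
  move=> af; apply: le_trans (rdot_le H _ _) _.
  by rewrite ler_wpM2r ?nrm_ge0// af.
have := le1 (A f) erefl; have := le1 _ (nrmZi H (A f)); lra.
Qed.

(** The factor 3/2 is the sum of the geometric series of ratio 1/3; the explicit tail bound is what
    the gliding hump argument uses. *)
Lemma geometric_cvg (x : nat -> V) :
  (forall k, nrm (x k.+1 - x k) <= 3^-1 ^+ k) ->
  exists f, forall k, nrm (f - x k) <= 3 / 2 * 3^-1 ^+ k.
Proof.
move=> dx.
have dist k j : nrm (x (k + j)%N - x k) <= 3 / 2 * 3^-1 ^+ k - 3 / 2 * 3^-1 ^+ (k + j).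
  elim: j => [|j IH]; first by rewrite addn0 !subrr nrm0.
  rewrite addnS exprS; have := nrm_triangle H (x (k + j).+1) (x (k + j)%N) (x k).
  have := dx (k + j)%N; lra.
have dist' k m : (k <= m)%N -> nrm (x m - x k) <= 3 / 2 * 3^-1 ^+ k.
  move=> /subnKC <-; apply: le_trans (dist _ _) _.
  by rewrite lerBlDr lerDl mulr_ge0// exprn_ge0// invr_ge0.
have small e : 0 < e -> exists M, 3 * (3^-1 : R) ^+ M < e.
  move=> e0; have e3 : 0 < e / 3 by rewrite divr_gt0.
  have : (3^-1 : R) ^+ n @[n --> \oo] --> (0 : R).
    by apply: cvg_expr; rewrite ger0_norm// invf_lt1// ltr1n.
  move=> /cvg0P /(_ _ e3) [M /(_ _ (leqnn M))].
  by rewrite ger0_norm ?exprn_ge0// => ?; exists M; lra.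
have [e e0|f xf] := hilbert_complete H (u := x).
  have [M Me] := small _ e0; exists M => m n /dist' mM /dist' nM.
  have := nrm_triangle H (x m) (x M) (x n); rewrite (nrmB H (x M) (x n)); lra.
exists f => k; rewrite nrmB//; apply: (nrm_le_lim xf).
by exists k => n /dist'; rewrite nrmB.
Qed.

(* Gliding hump, in the form without Baire category due to Sokal. *)
Lemma uniform_boundedness (u : nat -> V) :
  (forall h, exists C, forall n, `|rd (u n) h| <= C) ->
  exists2 C, 0 <= C & forall n, nrm (u n) <= C.
Proof.
move=> bnd; apply: contrapT => unbounded.
have large (M : R) : exists n, M < nrm (u n).
  apply: contrapT => nM; apply: unbounded; exists (`|M|) => // n.
  rewrite (le_trans _ (ler_norm _))// leNgt; apply/negP => Mn.
  by apply: nM; exists n.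
(* The threshold is fixed by the end of the argument: half of the hump, 3^-k times the norm over 2,
   must exceed [k]. *)
have [nk nkP] := choice (fun k : nat => large (2 * 3 ^+ k * k%:R)).
have u0 k : 0 < nrm (u (nk k)).
  by apply: le_lt_trans (nkP k); rewrite !mulr_ge0// exprn_ge0.
pose r k : R := 3^-1 ^+ k / nrm (u (nk k)).
have r0 k : 0 <= r k by rewrite mulr_ge0 ?invr_ge0 ?exprn_ge0 ?nrm_ge0.
pose sg (a : R) : R := if 0 <= a then 1 else -1.
have sgE a : a * sg a = `|a|.
  by rewrite /sg; case: ger0P; rewrite ?mulr1 ?mulrN1.
have sg1 a : `|sg a| = 1 by rewrite /sg; case: ifP; rewrite ?normrN1 ?normr1.
(* The sign aligns the increment with the current value of the pairing, so that the two add up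
   instead of cancelling. *)
pose step k x := x + ((sg (rd (u (nk k)) x) * r k)%:C)%C *: u (nk k).
pose fix x k := if k is j.+1 then step j (x j) else 0.
have dx k : nrm (x k.+1 - x k) <= 3^-1 ^+ k.
  rewrite /= /step [_ + _ - _]addrAC subrr add0r nrmZ// normrM sg1 mul1r.
  by rewrite ger0_norm// divfK// gt_eqF.
have hump k : 3^-1 ^+ k * nrm (u (nk k)) <= `|rd (u (nk k)) (x k.+1)|.
  rewrite /= /step rdotDr// rdotZr//; set a := rd (u (nk k)) (x k).
  have {1}-> : a = `|a| * sg a.
    by rewrite -sgE -mulrA -expr2 -real_normK ?num_real// sg1 expr1n mulr1.
  rewrite (_ : _ + _ = (`|a| + r k * rd (u (nk k)) (u (nk k))) * sg a); last by ring.
  rewrite normrM sg1 mulr1 -nrm2//.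
  rewrite (_ : r k * _ = 3^-1 ^+ k * nrm (u (nk k))); last first.
    by rewrite /r; field; rewrite gt_eqF.
  by rewrite ger0_norm ?lerDr// addr_ge0// mulr_ge0 ?exprn_ge0 ?invr_ge0 ?nrm_ge0.
have [f fP] := geometric_cvg dx.
have [C CP] := bnd f.
have big k : k%:R <= C.
  apply: le_trans (CP (nk k)).
  have d1 := rdot_le H (u (nk k)) (x k.+1 - f).
  have d2 : `|rd (u (nk k)) (x k.+1)| <= `|rd (u (nk k)) f| + `|rd (u (nk k)) (x k.+1 - f)|.
    by rewrite -{1}(subrK f (x k.+1)) rdotDr// addrC ler_normD.
  (* All later increments together amount to 3/2 times 3^-(k+1), which is half of 3^-k: they destroy
     at most half of the hump. *)
  have d3 : nrm (u (nk k)) * nrm (x k.+1 - f) <= nrm (u (nk k)) * (2^-1 * 3^-1 ^+ k).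
    rewrite ler_pM2l// nrmB// (le_trans (fP k.+1))// exprS.
    by rewrite le_eqVlt; apply/orP; left; apply/eqP; field.
  have d4 : k%:R <= 2^-1 * (3^-1 ^+ k * nrm (u (nk k))).
    rewrite mulrA; apply: le_trans (ler_wpM2l _ (ltW (nkP k))); last first.
      by rewrite mulr_ge0// exprn_ge0 ?invr_ge0.
    rewrite (_ : _ * (_ * _) = (3^-1 ^+ k * 3 ^+ k) * k%:R); last first.
      by move: (3^-1 ^+ k) (3 ^+ k) => a b; field.
    by rewrite -exprMn mulVf// expr1n mul1r.
  by have := hump k; move: d1 d2 d3 d4; lra.
have [k kC] : exists k : nat, C < k%:R by exists (Num.trunc C).+1; rewrite truncnS_gt.
by have := big k; rewrite leNgt kC.
Qed.
End hilbert_projection.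

(** * Weak sequential compactness of balls *)

Section weak_compactness.
Variables (R : realType) (V : lmodType R[i]) (dot : V -> V -> R[i]).
Hypothesis H : is_hilbert dot.
Local Notation rd := (rdot dot).
Local Notation nrm := (hnorm dot).
Implicit Types (f g h : V) (r : R) (N : set V).

Lemma wcvg_bounded (u : nat -> V) f : wcvg dot u f ->
  exists2 C, 0 <= C & forall n, nrm (u n) <= C.
Proof.
move=> uf; apply: uniform_boundedness => // h.
have [M [_ MP]] := cvg_seq_bounded (cvgP _ (uf h)).
by exists (M + 1) => n; apply: (MP (M + 1)) => //; rewrite ltrDl.
Qed.

(** The uniform bound is what makes the set closed; convergence of pairings then needs checking on a
    total sequence only. *)
Lemma wcvg0_subspace (u : nat -> V) (C : R) : (forall n, nrm (u n) <= C) ->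
  closed_subspace dot [set h | rd (u n) h @[n --> \oo] --> (0 : R)].
Proof.
move=> uC; split=> [|r f g /= uf ug|f cl] /=.
- by under eq_fun do rewrite rdot0r//; exact: cvg_cst.
- under eq_fun do rewrite rdotDr// rdotZr//.
  by have := cvgD (cvgM (cvg_cst r) uf) ug; rewrite mulr0 addr0; apply.
- apply/cvg0P => e e0; have C0 : 0 < `|C| + 1 by rewrite ltr_wpDl.
  have e2 : 0 < e / 2 by rewrite divr_gt0.
  have [g /cvg0P/(_ _ e2)[M MP] fg] := cl _ (divr_gt0 e2 C0).
  exists M => n /MP ug; rewrite -(subrK g f) rdotDr//.
  apply: le_lt_trans (ler_normD _ _) _; rewrite [e]splitr ler_ltD//.
  apply: le_trans (rdot_le H _ _) _.
  move: fg; rewrite ltr_pdivlMr// => /ltW; apply: le_trans.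
  rewrite mulrC ler_wpM2l ?nrm_ge0// (le_trans (uC n))//.
  by rewrite (le_trans (ler_norm C))// lerDl.
Qed.

Lemma ultra_cvg_bounded (F : set_system nat) (x : nat -> R) (c : R) :
  UltraFilter F -> (forall n, `|x n| <= c) -> exists l : R, x @ F --> l.
Proof.
move=> FU xc.
have : compact `[- c, c] by exact: segment_compact.
have FF : ProperFilter F by exact: ultra_proper.
move=> /(_ (x @ F) _) [|l [_ xl]].
  by apply: (@filterS _ F _ setT) => [n _ /=|]; [rewrite in_itv/= -ler_norml|exact: filterT].
exists l => B Bl; have [//|FnB] := in_ultra_setVsetC (x @^-1` B) FU.
by have [y []] := xl (~` B) B FnB Bl.
Qed.

(* A weak cluster point comes from an ultrafilter; the total sequence allows to
   extract from it a genuine subsequence. *)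
Lemma weak_compactness (e : nat -> V) (u : nat -> V) (C : R) :
  total_seq dot e -> (forall n, nrm (u n) <= C) ->
  exists (phi : nat -> nat) f, {homo phi : m n / (m < n)%N} /\
    wcvg dot (u \o phi) f.
Proof.
move=> tot uC.
have [F [FU sF]] := ultraFilterLemma eventually_filter.
have FF : ProperFilter F by exact: ultra_proper.
have bnd h n : `|rd (u n) h| <= C * nrm h.
  by apply: le_trans (rdot_le H _ _) _; rewrite ler_wpM2r ?nrm_ge0.
have [L LP] := choice (fun h => ultra_cvg_bounded FU (bnd h)).
(* The limit of the pairings along the ultrafilter is linear and bounded in the test vector, so
   Riesz turns it into the candidate weak limit [f]. *)
have [r f g|h|f fP] := @riesz_real _ _ _ H L C.
- have := cvgD (cvgM (cvg_cst r) (LP f)) (LP g).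
  rewrite (_ : _ + _ = (fun n => rd (u n) ((r%:C)%C *: f + g))).
    by move=> X; exact: (cvg_unique (@Rhausdorff R) (LP _) (X _ _ _)).
  by apply/funext => n /=; rewrite rdotDr// rdotZr.
- have Lh : (fun n => `|rd (u n) h|) @ F --> `|L h| by apply: cvg_norm; exact: LP.
  by apply: (cvgr_to_le Lh); apply: nearW => n; exact: bnd.
(* Finitely many conditions, each holding on a set of [F], hold together on a set of [F], and this
   set meets every tail since [F] refines the eventual filter. *)
have near_e (k M : nat) : exists n, (M < n)%N /\
    forall m, (m <= k)%N -> `|rd (u n - f) (e m)| < k.+1%:R^-1.
  have k0 : 0 < (k.+1%:R : R)^-1 by rewrite invr_gt0.
  have nearm m : F [set n | `|rd (u n - f) (e m)| < k.+1%:R^-1].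
    have := LP (e m); rewrite fP => /cvgrPdist_lt /(_ _ k0).
    by apply: filterS => n /=; rewrite rdotBl// distrC [rd (e m) f]rdotC.
  have Fk j : F [set n | forall m, (m <= j)%N -> `|rd (u n - f) (e m)| < k.+1%:R^-1].
    elim: j => [|j IH].
      by apply: filterS (nearm 0) => n /= ? m; rewrite leqn0 => /eqP ->.
    apply: filterS2 IH (nearm j.+1) => n /= IH ? m.
    by rewrite leq_eqVlt ltnS => /predU1P[->//|]; exact: IH.
  have FM : F [set n | (M < n)%N] by apply: sF; exists M.+1.
  have [n [nM nP]] := filter_ex (filterI FM (Fk k)).
  by exists n.
have [g gP] := choice (fun p : nat * nat => near_e p.1 p.2).
pose phi := fix phi k := if k is j.+1 then g (k, phi j) else g (0, 0)%N.
have phi_lt k : (phi k < phi k.+1)%N by have [] := gP (k.+1, phi k).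
have phiP k m : (m <= k)%N -> `|rd (u (phi k) - f) (e m)| < k.+1%:R^-1.
  case: k => [|k] mk; first by have [_ ->] := gP (0, 0)%N.
  by have [_ ->] := gP (k.+1, phi k).
exists phi, f; split; first exact: (homo_ltn ltn_trans).
move=> h.
have uC' n : nrm (u (phi n) - f) <= C + nrm f.
  by have := nrmD H (u (phi n)) (- f); rewrite nrmN//; have := uC (phi n); lra.
have : rd (u (phi n) - f) h @[n --> \oo] --> (0 : R).
  apply: (total_subspace H tot (wcvg0_subspace uC')) => m /=.
  apply/cvg0P => a a0; have [M _ MP] := near_infty_natSinv_lt (PosNum a0).
  exists (maxn m M) => n; rewrite geq_max => /andP[mn Mn].
  by apply: lt_trans (phiP _ _ mn) (MP _ Mn).
move=> /(cvgD (cvg_cst (rd f h))); rewrite addr0.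
rewrite (_ : _ + _ = (fun n => rd ((u \o phi) n) h))//.
by apply/funext => n; rewrite -[LHS]/(rd f h + rd (u (phi n) - f) h) rdotBl// addrC subrK.
Qed.

End weak_compactness.

(** * Separability and weakly measurable vector-valued functions *)

Section separable.
Variables (R : realType) (V : lmodType R[i]) (dot : V -> V -> R[i]).
Hypothesis H : is_hilbert dot.
Local Notation rd := (rdot dot).
Local Notation nrm := (hnorm dot).

(** Finite combinations with rational coefficients are enumerated by [pickle], and their closure is
    a closed real subspace containing the total sequence, hence everything. *)
Lemma total_dense (e : nat -> V) : total_seq dot e ->
  exists y : nat -> V, forall f a, 0 < a -> exists k, nrm (f - y k) < a.
Proof.
move=> tot.
pose comb (s : seq (rat * nat)) : V :=
  \sum_(x <- s) ((ratr x.1 : R)%:C)%C *: e x.2.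
exists (fun k => oapp comb 0 (unpickle k)) => f a a0.
suff [s sP] : exists s, nrm (f - comb s) < a.
  by exists (pickle s); rewrite pickleK.
move: f a a0; have scomb (q : rat) s : exists s', comb s' = ((ratr q : R)%:C)%C *: comb s.
  exists [seq (q * x.1, x.2) | x <- s]; rewrite /comb big_map scaler_sumr.
  by apply: eq_bigr => x _ /=; rewrite scalerA -rmorphM/= -rmorphM.
suff cl : closed_subspace dot
    [set f | forall a, 0 < a -> exists s, nrm (f - comb s) < a].
  move=> f; apply: (total_subspace H tot cl) => k a a0 /=.
  by exists [:: (1, k)]; rewrite /comb big_seq1/= !rmorph1 scale1r subrr nrm0.
split=> [a a0|r f g /= fP gP a a0|f fP a a0] /=.
- by exists [::]; rewrite /comb big_nil subrr nrm0.
- have a3 : 0 < a / 3 by rewrite divr_gt0.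
  have r0 : 0 < `|r| + 1 by rewrite ltr_wpDl.
  have [s sP] := fP _ (divr_gt0 a3 r0); have [t tP] := gP _ a3.
  have c0 : 0 < nrm (comb s) + 1 by rewrite ltr_wpDl ?nrm_ge0.
  have rlt : r < r + a / 3 / (nrm (comb s) + 1) by rewrite ltrDl divr_gt0.
  have [q qP] := rat_in_itvoo rlt.
  have [s' s'P] := scomb q s.
  exists (s' ++ t); rewrite /comb big_cat/= -/(comb s') -/(comb t) s'P.
  (* Three errors of at most a third of [a] each: approximating [f], replacing [r] by the rational
     [q], and approximating [g]. *)
  rewrite (_ : _ - _ = (r%:C)%C *: (f - comb s) +
      ((r - ratr q)%:C)%C *: comb s + (g - comb t)); last first.
    rewrite rmorphB scalerBr scalerBl [X in _ = X + _]addrA subrK.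
    by rewrite opprD addrACA.
  have := nrmD H ((r%:C)%C *: (f - comb s) + ((r - ratr q)%:C)%C *: comb s) (g - comb t).
  have := nrmD H ((r%:C)%C *: (f - comb s)) (((r - ratr q)%:C)%C *: comb s).
  rewrite !nrmZ//.
  have : `|r| * nrm (f - comb s) <= a / 3.
    move: sP; rewrite ltr_pdivlMr// => /ltW; apply: le_trans.
    by rewrite mulrC ler_wpM2l ?nrm_ge0// lerDl.
  have : `|r - ratr q| * nrm (comb s) <= a / 3.
    move: qP; rewrite in_itv/= => /andP[rq]; rewrite -ltrBlDl => qr.
    rewrite distrC gtr0_norm ?subr_gt0//.
    move: qr; rewrite ltr_pdivlMr// => /ltW; apply: le_trans.
    by rewrite ler_wpM2l ?lerDl// subr_ge0 ltW.
  move: tP; lra.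
- have a2 : 0 < a / 2 by rewrite divr_gt0.
  have [g gP fg] := fP _ a2; have [s sP] := gP _ a2; exists s.
  have := nrm_triangle H f g (comb s); lra.
Qed.

Section weakly_measurable.
Context d (T : measurableType d).

(** Measurability is tested against vectors, since [V] carries no sigma-algebra. *)
Definition weakly_measurable (g : T -> V) :=
  forall h, measurable_fun setT (fun z => rd (g z) h).

Lemma weakly_measurableD g1 g2 : weakly_measurable g1 -> weakly_measurable g2 ->
  weakly_measurable (g1 \+ g2).
Proof.
move=> m1 m2 h; under eq_fun do rewrite rdotDl//.
exact: measurable_funD.
Qed.

Lemma weakly_measurableN g : weakly_measurable g -> weakly_measurable (\- g).
Proof.
move=> m h; under eq_fun do rewrite rdotNl//.
exact: measurableT_comp.
Qed.

(** The adjoint moves [A] onto the fixed test vector. *)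
Lemma weakly_measurable_op (A : V -> V) (C : R) g :
  (forall a f g, A (a *: f + g) = a *: A f + A g) ->
  (forall f, nrm (A f) <= C * nrm f) ->
  weakly_measurable g -> weakly_measurable (A \o g).
Proof.
move=> lin bnd m h; have [h' hP] := adjoint_exists H lin bnd h.
by under eq_fun do rewrite /= /rdot hP; exact: m.
Qed.

(** For a dense sequence [y], the squared norm of v is the supremum over k of |v|^2 - |v - y_k|^2 =
    2 <v, y_k> - |y_k|^2, and each of these is affine in v. *)
Lemma weakly_measurable_nrm2 (e : nat -> V) g : total_seq dot e ->
  weakly_measurable g -> measurable_fun setT (fun z => rd (g z) (g z)).
Proof.
move=> /total_dense[y yP] mg.
pose x k z := 2 * rd (g z) (y k) - rd (y k) (y k).
have xE k z : x k z = rd (g z) (g z) - nrm (g z - y k) ^+ 2.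
  by rewrite nrm2B// /x !nrm2//; ring.
have ub z : ubound (range (x ^~ z)) (rd (g z) (g z)).
  by move=> _ [k _ <-]; rewrite xE gerBl sqr_ge0.
rewrite (_ : (fun z => _) = (fun z => sups (x ^~ z) 0)).
  apply: measurable_fun_sups => [z _|k]; first by exists (rd (g z) (g z)).
  by apply: measurable_funB => //; apply: measurable_funM => //; exact: mg.
apply/funext => z; rewrite /sups/=.
rewrite (_ : sdrop _ 0 = range (x ^~ z)); last first.
  by apply/seteqP; split => w [k _ <-]; exists k.
apply/eqP; rewrite eq_le; apply/andP; split; last first.
  by apply: ge_sup => //; exists (x 0 z); exists 0.
apply/ler_addgt0Pr => a a0.
have b0 : 0 < Num.sqrt a by rewrite sqrtr_gt0.
have [k kP] := yP (g z) _ b0.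
have : x k z <= sup (range (x ^~ z)).
  by apply: ub_le_sup; [exists (rd (g z) (g z))|exists k].
rewrite xE; move: kP; rewrite -ltr_sqr ?nnegrE ?nrm_ge0 ?sqrtr_ge0//.
by rewrite (sqr_sqrtr (ltW a0))//; lra.
Qed.

Lemma weakly_measurable_rdot (e : nat -> V) g1 g2 : total_seq dot e ->
  weakly_measurable g1 -> weakly_measurable g2 ->
  measurable_fun setT (fun z => rd (g1 z) (g2 z)).
Proof.
move=> tot m1 m2.
rewrite (_ : (fun z => _) = (fun z => 4^-1 * (rd ((g1 \+ g2) z) ((g1 \+ g2) z) -
    rd ((g1 \+ (\- g2)) z) ((g1 \+ (\- g2)) z)))).
  apply: measurable_funM => //; apply: measurable_funB => //.
    by apply: (weakly_measurable_nrm2 tot); exact: weakly_measurableD.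
  apply: (weakly_measurable_nrm2 tot); apply: weakly_measurableD => //.
  exact: weakly_measurableN.
apply/funext => z /=; rewrite -!nrm2// nrm2B// nrm2D//.
by field.
Qed.

End weakly_measurable.
End separable.

(** * The Hilbert space L2 *)

Section cintegral_theory.
Context dT (T : measurableType dT) (R : realType).
Variable mu : {measure set T -> \bar R}.
Implicit Types f g : T -> R[i].

Definition cintegrable f :=
  mu.-integrable setT (EFin \o (fun x => complex.Re (f x))) /\
  mu.-integrable setT (EFin \o (fun x => complex.Im (f x))).

Lemma cintegralD f g : cintegrable f -> cintegrable g ->
  cintegral mu (f \+ g) = cintegral mu f + cintegral mu g.
Proof.
move=> [f1 f2] [g1 g2]; apply: complex_ext; rewrite ?cReD ?cImD /cintegral/=.
  by rewrite -RintegralD//; apply: eq_Rintegral => x _; rewrite cReD.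
by rewrite -RintegralD//; apply: eq_Rintegral => x _; rewrite cImD.
Qed.

Lemma cintegralZ a f : cintegrable f ->
  cintegral mu (fun x => a * f x) = a * cintegral mu f.
Proof.
move=> [f1 f2].
have i1 b : mu.-integrable setT (EFin \o (fun x => b * complex.Re (f x))).
  by move: (integrableZl measurableT b f1).
have i2 b : mu.-integrable setT (EFin \o (fun x => b * complex.Im (f x))).
  by move: (integrableZl measurableT b f2).
apply: complex_ext; rewrite ?cReM ?cImM /cintegral/=.
  by rewrite -!RintegralZl// -RintegralB//; apply: eq_Rintegral => x _; rewrite cReM.
by rewrite -!RintegralZl// -RintegralD//; apply: eq_Rintegral => x _; rewrite cImM.
Qed.

Lemma cmeasurableJ f : cmeasurable f -> cmeasurable (fun x => (f x)^*).
Proof.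
move=> [f1 f2]; split; first by under eq_fun do rewrite cReJ.
by under eq_fun do rewrite cImJ; exact: measurableT_comp.
Qed.

Lemma cintegral_ae f g : cmeasurable f -> cmeasurable g ->
  {ae mu, forall x, f x = g x} -> cintegral mu f = cintegral mu g.
Proof.
move=> [f1 f2] [g1 g2] fg; congr Complex; congr fine.
  apply: ae_eq_integral => //; [exact/measurable_EFinP|exact/measurable_EFinP|].
  by apply: filterS fg => x ->.
apply: ae_eq_integral => //; [exact/measurable_EFinP|exact/measurable_EFinP|].
by apply: filterS fg => x ->.
Qed.

End cintegral_theory.

Section L2_hilbert.
Context dT (T : measurableType dT) (R : realType).
Variable mu : {measure set T -> \bar R}.
Implicit Types f g h : L2 mu.
Local Open Scope quotient_scope.

Lemma L2fun_cmeasurable (f : L2fun mu) : cmeasurable f.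
Proof. by have /asboolP[] := L2fun_sqintegrable f. Qed.

Lemma L2repr_cmeasurable f : cmeasurable (L2repr f).
Proof. exact: L2fun_cmeasurable. Qed.

Lemma L2fun_cabs (f : L2fun mu) : (fun x => cabs (f x)) \in Lfun mu 2%:E.
Proof.
have /asboolP[mf fi] := L2fun_sqintegrable f.
by rewrite inE; apply/andP; split; rewrite inE//; exact: measurable_cabs.
Qed.

Lemma cabsJ (z : R[i]) : cabs z^* = cabs z.
Proof. by rewrite !cabs_sqrt cReJ cImJ sqrrN. Qed.

Lemma L2fun_integrableM (f g : L2fun mu) :
  cintegrable mu (fun x => f x * (g x)^*).
Proof.
have mfg : cmeasurable (fun x => f x * (g x)^*).
  by apply: cmeasurableM; [|apply: cmeasurableJ]; exact: L2fun_cmeasurable.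
have /Lfun1_integrable ifg := Lfun2_mul_Lfun1 (L2fun_cabs f) (L2fun_cabs g).
split; apply: le_integrable ifg => //.
- by case: mfg => m _; exact/measurable_EFinP.
- move=> x _ /=; rewrite lee_fin (le_trans (cabs_ge_Re _))//.
  by rewrite cabsM cabsJ ler_norm.
- by case: mfg => _ m; exact/measurable_EFinP.
- move=> x _ /=; rewrite lee_fin (le_trans (cabs_ge_Im _))//.
  by rewrite cabsM cabsJ ler_norm.
Qed.

Lemma L2dot_ae f g (F G : T -> R[i]) : cmeasurable F -> cmeasurable G ->
  {ae mu, forall x, L2repr f x = F x} -> {ae mu, forall x, L2repr g x = G x} ->
  L2dot f g = cintegral mu (fun x => F x * (G x)^*).
Proof.
move=> mF mG fF gG; apply: cintegral_ae.
- by apply: cmeasurableM; [|apply: cmeasurableJ]; exact: L2repr_cmeasurable.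
- by apply: cmeasurableM => //; exact: cmeasurableJ.
- by apply: filterS2 fF gG => x -> ->.
Qed.

Lemma L2reprD f g : {ae mu, forall x, L2repr (f + g) x = L2repr f x + L2repr g x}.
Proof.
have := L2repr_pi ((repr f : L2fun mu) + (repr g : L2fun mu)).
by rewrite L2piD !reprK.
Qed.

Lemma L2reprZ a f : {ae mu, forall x, L2repr (a *: f) x = a * L2repr f x}.
Proof. exact: (L2repr_pi (a *: (repr f : L2fun mu))). Qed.

Lemma L2dotDl f g h : L2dot (f + g) h = L2dot f h + L2dot g h.
Proof.
rewrite -cintegralD; [|exact: L2fun_integrableM|exact: L2fun_integrableM].
rewrite (L2dot_ae _ _ (L2reprD f g) (nearW _ (fun=> erefl))).
- by congr cintegral; apply/funext => x /=; rewrite mulrDl.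
- by apply: cmeasurableD; exact: L2repr_cmeasurable.
- exact: L2repr_cmeasurable.
Qed.

Lemma L2dotZl a f h : L2dot (a *: f) h = a * L2dot f h.
Proof.
rewrite -cintegralZ; last exact: L2fun_integrableM.
rewrite (L2dot_ae _ _ (L2reprZ a f) (nearW _ (fun=> erefl))).
- by congr cintegral; apply/funext => x /=; rewrite mulrA.
- exact: cmeasurableM (cmeasurable_cst _ a) (L2repr_cmeasurable f).
- exact: L2repr_cmeasurable.
Qed.

Lemma L2dotJ f g : L2dot g f = (L2dot f g)^*.
Proof.
have [_ i2] := L2fun_integrableM (repr f) (repr g).
apply: complex_ext; rewrite ?cReJ ?cImJ /=.
  by apply: eq_Rintegral => x _; rewrite !cReM !cReJ !cImJ; ring.
rewrite -mulN1r -RintegralZl//; apply: eq_Rintegral => x _.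
by rewrite !cImM !cReJ !cImJ; ring.
Qed.

Lemma L2norm2 (f : L2fun mu) :
  ((L2norm mu f ^+ 2)%:E = \int[mu]_x (cabs (f x) ^+ 2)%:E)%E.
Proof.
transitivity ((L2norm mu f)%:E `^ 2)%E.
  by rewrite poweR_EFin -powR_mulrn ?L2norm_ge0.
rewrite L2norm_fin powR_Lnorm//; apply: eq_integral => x _ /=.
by rewrite -powR_mulrn ?cabs_ge0// ger0_norm// cabs_ge0.
Qed.

Lemma cabs2 (z : R[i]) : cabs z ^+ 2 = complex.Re (z * z^*).
Proof.
rewrite cabs_sqrt sqr_sqrtr ?addr_ge0 ?sqr_ge0// cReM cReJ cImJ.
by ring.
Qed.

Lemma rdot_L2norm f : rdot (@L2dot _ _ _ mu) f f = L2norm mu (L2repr f) ^+ 2.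
Proof.
apply: EFin_inj; rewrite L2norm2 /rdot /L2dot /cintegral/= /Rintegral fineK.
  by apply: eq_integral => x _; rewrite cabs2.
have [/integrable_fin_num] := L2fun_integrableM (repr f) (repr f).
by move=> /(_ measurableT).
Qed.

Lemma hnorm_L2 f : hnorm (@L2dot _ _ _ mu) f = complex.Re `|f|.
Proof. by rewrite /hnorm rdot_L2norm sqrtr_sqr ger0_norm// L2norm_ge0. Qed.

Lemma L2_normC f : `|f| = ((hnorm (@L2dot _ _ _ mu) f)%:C)%C.
Proof. by rewrite hnorm_L2 L2_normE. Qed.

End L2_hilbert.

(** * Completeness of L2 *)

Section riesz_fischer.
Context dT (T : measurableType dT) (R : realType).
Variable mu : {measure set T -> \bar R}.
Local Open Scope quotient_scope.
Local Notation nrm := (hnorm (@L2dot _ _ _ mu)).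

Lemma hnorm_pi (f : L2fun mu) : nrm (\pi_(L2 mu) f) = L2norm mu f.
Proof. by rewrite hnorm_L2 L2_normE/=; apply/L2norm_ae/L2repr_pi. Qed.

Lemma L2piB (f g : L2fun mu) : \pi_(L2 mu) (f - g) = \pi_(L2 mu) f - \pi_(L2 mu) g.
Proof. by rewrite [LHS]raddfB. Qed.

Lemma L2_hnormD (f g : L2 mu) : nrm (f + g) <= nrm f + nrm g.
Proof. by rewrite -lecR rmorphD/= -!L2_normC ler_normD. Qed.

Lemma L2_hnorm_leD (f g : L2 mu) : nrm f <= nrm (f - g) + nrm g.
Proof. by rewrite -{1}(subrK g f) L2_hnormD. Qed.

Lemma fatou_le (f : nat -> T -> R) (g : T -> R) (c : \bar R) :
  (forall n, measurable_fun setT (f n)) -> (forall n x, 0 <= f n x) ->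
  (forall x, f n x @[n --> \oo] --> g x) ->
  (forall n, (\int[mu]_x (f n x)%:E <= c)%E) -> (\int[mu]_x (g x)%:E <= c)%E.
Proof.
move=> mf f0 fg fc.
have := @fatou _ _ _ mu setT measurableT (fun n x => (f n x)%:E).
move=> /(_ _)/wrap[]; first by move=> n; exact/measurable_EFinP.
move=> /(_ _)/wrap[]; first by move=> n x _; rewrite lee_fin.
rewrite (_ : (fun x => limn_einf _) = (fun x => (g x)%:E)); last first.
  apply/funext => x; have gx : (f n x)%:E @[n --> \oo] --> (g x)%:E.
    by apply: cvg_EFin (fg x); apply: nearW.
  by have [-> _] := cvg_limn_einf_sup gx.
move=> /le_trans; apply; rewrite limn_einf_lim.
apply: lime_le; first exact: is_cvg_einfs.
apply: nearW => n; apply: le_trans (fc n).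
by apply: ereal_inf_lbound; exists n => /=.
Qed.

(** The weights let square integrability control a plain sum: with p = 2^k, expanding p (x - 1/p)^2
    >= 0 bounds 2x by p x^2 + 1/p, and both sums converge. *)
Lemma summable_weighted (a : nat -> R) : (forall k, 0 <= a k) ->
  (\sum_(k <oo) (2 ^+ k * a k ^+ 2)%:E < +oo)%E -> cvgn (series a).
Proof.
move=> a0 fin; pose b k := 2 ^+ k * a k ^+ 2.
have b0 k : 0 <= b k by rewrite mulr_ge0 ?sqr_ge0 ?exprn_ge0.
have cb : cvgn (series b).
  apply: nondecreasing_is_cvgn.
    by apply/nondecreasing_seqP => n; rewrite seriesSr lerDl.
  exists (fine (\sum_(k <oo) (b k)%:E)%E) => _ [n _ <-].
  rewrite -lee_fin fineK; last first.
    by rewrite ge0_fin_numE// nneseries_ge0// => k _ _; rewrite lee_fin.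
  rewrite /series/= -sumEFin; apply: nneseries_lim_ge => k _ _.
  by rewrite lee_fin.
have cg : cvgn (series (geometric 1 (2^-1 : R))).
  by apply: is_cvg_geometric_series; rewrite ger0_norm// invf_lt1// ltr1n.
apply: (@series_le_cvg _ a (fun k => b k + geometric 1 2^-1 k)) => // [k|k|].
- by rewrite addr_ge0// /= mul1r exprn_ge0// invr_ge0.
- rewrite /b /= mul1r exprVn.
  have p0 : 0 < (2 : R) ^+ k by rewrite exprn_gt0.
  move: (2 ^+ k) p0 (a k) (a0 k) => p p0 x x0.
  have : 0 <= p * (x - p^-1) ^+ 2 by rewrite mulr_ge0 ?sqr_ge0// ltW.
  rewrite (_ : p * _ = p * x ^+ 2 - 2 * x + p^-1); first lra.
  by field; rewrite gt_eqF.
- rewrite (_ : series _ = series b + series (geometric 1 2^-1)); first exact: is_cvgD.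
  by apply/funext => n; rewrite /series/= big_split.
Qed.

Lemma sqintegrable_of_int (g : T -> R[i]) : cmeasurable g ->
  (\int[mu]_x (cabs (g x) ^+ 2)%:E < +oo)%E -> g \in sqintegrable mu.
Proof.
move=> mg gi; apply/asboolP; split => //.
rewrite /finite_norm unlock /= poweR_lty//.
rewrite (eq_integral (fun x => (cabs (g x) ^+ 2)%:E))// => x _.
by rewrite ger0_norm ?cabs_ge0// powR_mulrn ?cabs_ge0.
Qed.

Lemma cvg_increments (x a : nat -> R) : (forall k, `|x k.+1 - x k| <= a k) ->
  cvgn (series a) -> cvgn x.
Proof.
move=> xa ca.
have : cvgn [normed series (telescope x)].
  apply: (@series_le_cvg _ _ a) => // k; first exact: normr_ge0.
  by apply: le_trans (xa k).
move=> /normed_cvg; rewrite telescopeK => cx.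
rewrite (_ : x = (fun n => (x n - x 0) + x 0)); last first.
  by apply/funext => n; rewrite subrK.
by apply: is_cvgD => //; exact: is_cvg_cst.
Qed.

Lemma cabs_sq (z : R[i]) : cabs z ^+ 2 = complex.Re z ^+ 2 + complex.Im z ^+ 2.
Proof. by rewrite cabs_sqrt sqr_sqrtr ?addr_ge0 ?sqr_ge0. Qed.

Lemma cabsN (z : R[i]) : cabs (- z) = cabs z.
Proof. by rewrite /cabs normrN. Qed.

Lemma cmeasurableB (f g : T -> R[i]) :
  cmeasurable f -> cmeasurable g -> cmeasurable (f \- g).
Proof.
move=> mf mg; rewrite (_ : _ \- _ = f \+ (fun x => -1 * g x)).
  exact: cmeasurableD mf (cmeasurableM (cmeasurable_cst _ (-1)) mg).
by apply/funext => x /=; rewrite mulN1r.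
Qed.

Lemma L2_fast_cauchy (u : nat -> L2 mu) :
  (forall k, nrm (u k.+1 - u k) <= 2^-1 ^+ k) ->
  (forall e, 0 < e -> exists N, forall m n, (N <= m)%N -> (N <= n)%N ->
      nrm (u m - u n) < e) ->
  exists f, forall e, 0 < e -> exists N, forall n, (N <= n)%N -> nrm (u n - f) <= e.
Proof.
move=> fast cauchy.
pose g k : L2fun mu := repr (u k).
have ug k : u k = \pi_(L2 mu) (g k) by rewrite reprK.
pose D k x := cabs (g k.+1 x - g k x).
have mD k : measurable_fun setT (D k).
  apply: measurable_cabs; apply: (L2fun_cmeasurable (g k.+1 - g k)).
have intD m n : (\int[mu]_x (cabs (g m x - g n x) ^+ 2)%:E = (nrm (u m - u n) ^+ 2)%:E)%E.
  by rewrite !ug -L2piB hnorm_pi -/(g m) -/(g n) L2norm2.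
(* The weight 2^k still leaves a finite integral, as 2^k times the square of 2^-k is 2^-k, and
   finiteness of [F x] makes the increments at [x] summable. Only integrals of squares occur, so no
   infinite Minkowski inequality is involved. *)
pose F x := (\sum_(k <oo) (2 ^+ k * D k x ^+ 2)%:E)%E.
have F0 x : (0 <= F x)%E.
  by apply: nneseries_ge0 => k _ _; rewrite lee_fin mulr_ge0 ?sqr_ge0 ?exprn_ge0.
have mF : measurable_fun setT F.
  apply: (ge0_emeasurable_sum (P := xpredT)) => [k x _ _|k _].
    by rewrite lee_fin mulr_ge0 ?sqr_ge0 ?exprn_ge0.
  apply/measurable_EFinP; apply: measurable_funM => //.
  exact: measurable_funX.
have intF : (\int[mu]_x F x < +oo)%E.
  rewrite integral_nneseries//; last first.
  - by move=> k x _; rewrite lee_fin mulr_ge0 ?sqr_ge0 ?exprn_ge0.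
  - move=> k; apply/measurable_EFinP; apply: measurable_funM => //.
    exact: measurable_funX.
  apply: (@le_lt_trans _ _ (\sum_(k <oo) ((2^-1 : R) ^+ k)%:E)%E).
    apply: lee_nneseries => k _.
      by move=> _; apply: integral_ge0 => x _; rewrite lee_fin mulr_ge0 ?sqr_ge0 ?exprn_ge0.
    under eq_integral do rewrite EFinM.
    rewrite ge0_integralZl//=.
    + rewrite intD -EFinM lee_fin.
      apply: (@le_trans _ _ (2 ^+ k * (2^-1 ^+ k) ^+ 2)).
        by rewrite ler_pM2l ?exprn_gt0// ler_sqr ?nnegrE ?exprn_ge0 ?invr_ge0 ?nrm_ge0.
      by rewrite expr2 mulrA -exprMn mulfV// expr1n mul1r.
    + by apply/measurable_EFinP; exact: measurable_funX.
    + by move=> x _; rewrite lee_fin sqr_ge0.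
  have := @cvg_geometric_series R 1 2^-1.
  move=> /(_ _)/wrap[]; first by rewrite ger0_norm// invf_lt1// ltr1n.
  move=> cg; rewrite (_ : limn _ = (1 / (1 - 2^-1))%:E) ?ltry//.
  apply/cvg_lim => //; rewrite (_ : (fun n => _) = EFin \o series (geometric 1 2^-1)).
    by apply: cvg_EFin cg; apply: nearW.
  apply/funext => n /=; rewrite /series/= -sumEFin big_mkord.
  by rewrite big_mkord; apply: eq_bigr => i _; rewrite mul1r.
pose A := [set x | (F x < +oo)%E].
have mA : measurable A.
  by rewrite -[A]setTI; apply: emeasurable_fun_infty_o.
have aeA : {ae mu, forall x, A x}.
  have iF : mu.-integrable setT F.
    by apply/integrableP; split => //; under eq_integral do rewrite gee0_abs//.
  have := integrable_ae measurableT iF; apply: filterS => x /(_ I).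
  by rewrite /A/= ge0_fin_numE.
have DA x : A x -> cvgn (series (D ^~ x)).
  by move=> Ax; apply: summable_weighted Ax => k; exact: cabs_ge0.
(* Cutting off outside [A] changes each [g k] on a null set only and gives convergence at every
   point, as [measurable_fun_cvg] and [fatou_le] are used with pointwise limits. *)
pose h k x := ((\1_A x : R)%:C)%C * g k x.
have hA k x : A x -> h k x = g k x.
  by move=> Ax; rewrite /h indicE mem_set// rmorph1 mul1r.
have hNA k x : ~ A x -> h k x = 0.
  by move=> Ax; rewrite /h indicE memNset// rmorph0 mul0r.
have mh k : cmeasurable (h k).
  apply: cmeasurableM; last exact: L2fun_cmeasurable.
  by split => /=; [exact: measurable_indic|exact: measurable_cst].
have cvgRe x : cvgn (fun k => complex.Re (h k x)).
  have [Ax|Ax] := pselect (A x); last first.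
    by under eq_fun do rewrite hNA//; exact: is_cvg_cst.
  under eq_fun do rewrite hA//.
  apply: (cvg_increments _ (DA x Ax)) => k.
  by rewrite -cReN -cReD cabs_ge_Re.
have cvgIm x : cvgn (fun k => complex.Im (h k x)).
  have [Ax|Ax] := pselect (A x); last first.
    by under eq_fun do rewrite hNA//; exact: is_cvg_cst.
  under eq_fun do rewrite hA//.
  apply: (cvg_increments _ (DA x Ax)) => k.
  by rewrite -cImN -cImD cabs_ge_Im.
pose G x : R[i] := (limn (fun k => complex.Re (h k x)) +i*
                    limn (fun k => complex.Im (h k x)))%C.
have mG : cmeasurable G.
  split; [apply: (@measurable_fun_cvg _ _ _ _ (fun k x => complex.Re (h k x)))
         |apply: (@measurable_fun_cvg _ _ _ _ (fun k x => complex.Im (h k x)))] => //.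
  - by move=> k; have [] := mh k.
  - by move=> k; have [] := mh k.
have gh k : {ae mu, forall x, g k x = h k x}.
  by apply: filterS aeA => x Ax; rewrite hA.
(* The shift by [N] keeps only the tail governed by the Cauchy bound, because [fatou_le] asks for a
   bound on every term. *)
have cvgB (z : R[i]) N x :
    cabs (z - h (n + N)%N x) ^+ 2 @[n --> \oo] --> cabs (z - G x) ^+ 2.
  under eq_fun do rewrite cabs_sq cReD cImD cReN cImN.
  rewrite cabs_sq cReD cImD cReN cImN.
  have cR : complex.Re (h (n + N)%N x) @[n --> \oo] --> complex.Re (G x).
    by rewrite (cvg_shiftn N (fun k => complex.Re (h k x))); exact: cvgRe.
  have cI : complex.Im (h (n + N)%N x) @[n --> \oo] --> complex.Im (G x).
    by rewrite (cvg_shiftn N (fun k => complex.Im (h k x))); exact: cvgIm.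
  by apply: cvgD; (under eq_fun do rewrite expr2; rewrite expr2);
    apply: cvgM; apply: cvgB => //; exact: cvg_cst.
have intB (G' : T -> R[i]) (G'' : T -> R[i]) k : cmeasurable G' -> cmeasurable G'' ->
    {ae mu, forall x, G' x = G'' x} ->
    (\int[mu]_x (cabs (G' x - g k x) ^+ 2)%:E = \int[mu]_x (cabs (G'' x - h k x) ^+ 2)%:E)%E.
  move=> mG' mG'' GG; apply: ae_eq_integral => //.
  - apply/measurable_EFinP/measurable_funX/measurable_cabs.
    exact: cmeasurableB mG' (L2fun_cmeasurable _).
  - apply/measurable_EFinP/measurable_funX/measurable_cabs.
    exact: cmeasurableB.
  - by apply: filterS2 GG (gh k) => x -> ->.
have intG : (\int[mu]_x (cabs (G x) ^+ 2)%:E < +oo)%E.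
  have [N NP] := cauchy _ ltr01.
  apply: (@le_lt_trans _ _ ((nrm (u N) + 1) ^+ 2)%:E); last exact: ltry.
  under eq_integral do rewrite -cabsN -sub0r.
  apply: (@fatou_le (fun n x => cabs (0 - h (n + N)%N x) ^+ 2)).
  - move=> n; apply/measurable_funX/measurable_cabs.
    exact: cmeasurableB (cmeasurable_cst _ 0) (mh _).
  - by move=> n x; rewrite sqr_ge0.
  - by move=> x; exact: cvgB.
  - move=> n.
    have /= <- := intB (cst 0) (cst 0) (n + N)%N (cmeasurable_cst _ 0)
      (cmeasurable_cst _ 0) (nearW _ (fun=> erefl)).
    under eq_integral do rewrite sub0r cabsN.
    rewrite -L2norm2 -hnorm_pi -ug lee_fin ler_sqr ?nnegrE ?addr_ge0 ?nrm_ge0//.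
    rewrite addrC (le_trans (L2_hnorm_leD _ (u N)))// lerD2r ltW//.
    by rewrite NP// leq_addl.
pose G' : L2fun mu := L2Fun (sqintegrable_of_int mG intG).
exists (\pi_(L2 mu) G') => e e0.
have [N NP] := cauchy _ e0; exists N => n Nn.
rewrite -ler_sqr ?nnegrE ?nrm_ge0 ?(ltW e0)//.
rewrite ug -L2piB hnorm_pi -lee_fin L2norm2.
rewrite (_ : \int[mu]_x _ = \int[mu]_x (cabs (h n x - G x) ^+ 2)%:E)%E; last first.
  apply: ae_eq_integral => //.
  - apply/measurable_EFinP/measurable_funX/measurable_cabs.
    exact: (L2fun_cmeasurable (g n - G')).
  - apply/measurable_EFinP/measurable_funX/measurable_cabs.
    exact: cmeasurableB.
  - by apply: filterS (gh n) => x <-.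
(* With [n] fixed, Fatou in the second index turns the Cauchy bound into a bound on the distance to
   the limit. *)
apply: (@fatou_le (fun j x => cabs (h n x - h (j + N)%N x) ^+ 2)).
- move=> j; apply/measurable_funX/measurable_cabs; exact: cmeasurableB.
- by move=> j x; rewrite sqr_ge0.
- by move=> x; exact: cvgB.
- move=> j; rewrite -(intB (g n) (h n))//; last exact: L2fun_cmeasurable.
  by rewrite intD lee_fin ler_sqr ?nnegrE ?nrm_ge0 ?(ltW e0)// ltW// NP// leq_addl.
Qed.

Lemma L2_hilbert : is_hilbert (@L2dot _ _ _ mu).
Proof.
split; [exact: L2dotDl|exact: L2dotZl|exact: L2dotJ| | |].
- by move=> f; rewrite rdot_L2norm sqr_ge0.
- move=> f f0; apply/normr0_eq0.
  by rewrite L2_normC /hnorm f0 sqrtr0.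
- move=> u cauchy.
  have half_gt0 : 0 < (2^-1 : R) by rewrite invr_gt0.
  have [N NP] := choice (fun k => cauchy (2^-1 ^+ k) (exprn_gt0 k half_gt0)).
  (* Partial sums make the indices increase although [N] may not be monotone, while keeping [s k]
     above both [N k] and [k]. *)
  pose s k := (\sum_(j < k.+1) (N j).+1)%N.
  have sS k : s k.+1 = (s k + (N k.+1).+1)%N by rewrite /s big_ord_recr.
  have sN k : (N k <= s k)%N.
    by rewrite /s big_ord_recr/= (leq_trans (leqnSn _))// leq_addl.
  have sk k : (k <= s k)%N.
    by elim: k => // k IH; rewrite sS -addn1 leq_add.
  have [k|e e0|f fP] := @L2_fast_cauchy (u \o s).
  + by rewrite ltW//= NP// (leq_trans (sN k))// sS leq_addr.
  + have [M MP] := cauchy _ e0; exists M => m n Mm Mn.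
    by apply: MP; rewrite (leq_trans _ (sk _)).
  exists f; apply/cvg0P => e e0; have e2 : 0 < e / 2 by rewrite divr_gt0.
  have e3 : 0 < e / 3 by rewrite divr_gt0.
  have [M MP] := cauchy _ e2; have [M' MP'] := fP _ e3.
  exists M => n Mn; rewrite ger0_norm ?nrm_ge0//.
  have := L2_hnormD (u n - u (s (maxn M M'))) (u (s (maxn M M')) - f).
  rewrite addrA subrK.
  have := MP' _ (leq_maxr M M').
  have /= := MP _ (s (maxn M M')) Mn (leq_trans (leq_maxl M M') (sk _)).
  lra.
Qed.

End riesz_fischer.

(** * Functions with vanishing integrals over a pi-system *)

Section pi_system_ae0.
Context dT (T : measurableType dT) (R : realType).
Variables (mu : {measure set T -> \bar R}) (B : (set T)^nat).
Hypothesis BI : setI_closed (range B).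
Hypothesis BE : @measurable _ T = <<s range B >>.
Hypothesis BT : \bigcup_k B k = setT.

(** Dynkin induction: the vanishing integral over the whole space is what handles complements. *)
Let integrable_pi_ae0 (f : T -> R) : mu.-integrable setT (EFin \o f) ->
  (\int[mu]_x (f x)%:E = 0)%E ->
  (forall k, \int[mu]_(x in B k) (f x)%:E = 0)%E ->
  {ae mu, forall x, f x = 0}.
Proof.
move=> fi f0 fB.
have all0 A : measurable A -> (\int[mu]_(x in A) (f x)%:E = 0)%E.
  move=> mA; move: (mA); rewrite BE.
  apply: (dynkin_induction (P := fun A => (\int[mu]_(x in A) (f x)%:E = 0)%E) BE BI f0) => //.
  - by move=> _ [k _ <-]; exact: fB.
  - move=> C mC C0.
    have : (\int[mu]_(x in C `|` ~` C) (f x)%:E = 0)%E by rewrite setUv.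
    rewrite integral_setU//.
    + by rewrite C0 add0e.
    + exact: measurableC.
    + by rewrite setUv; case/integrableP : fi.
    + by rewrite disj_set2E setICr.
  - move=> F mF tF F0; rewrite integral_bigcup//.
    + by apply: eseries0 => k _ _; exact: F0.
    + by apply: integrableS fi => //; exact: bigcup_measurable.
have := @integral_ae_eq _ _ _ mu setT measurableT (cst 0%E) (EFin \o f) fi.
move=> /(_ (measurable_cst _) _)/wrap[].
  by move=> E _ mE; rewrite integral0 all0.
by move=> fae; apply: filterS fae => x /(_ I) [].
Qed.

(** Integrability is available only on each [B k], so the global criterion is applied to [f]
    restricted to [B n], whose integral over [B k] is an integral of [f] over another member of the
    pi-system. *)
Lemma pi_ae0 (f : T -> R) : measurable_fun setT f ->
  (forall k, mu.-integrable setT (EFin \o (fun x => f x * \1_(B k) x))) ->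
  (forall k, \int[mu]_x (f x * \1_(B k) x)%:E = 0)%E ->
  {ae mu, forall x, f x = 0}.
Proof.
move=> mf fi f0.
have fn n : {ae mu, forall x, f x * \1_(B n) x = 0}.
  apply: integrable_pi_ae0 => // k.
  have [j _ jE] : range B (B n `&` B k) by apply: BI; [exists n|exists k].
  rewrite -[RHS](f0 j) integral_mkcond; apply: eq_integral => x _.
  rewrite patchE jE indicI /=; case: ifPn => xB.
    by rewrite [\1_(B k) x]indicE xB mulr1.
  by rewrite [\1_(B k) x]indicE (negbTE xB) !mulr0.
have /ae_foralln := fn; apply: filterS => x fx.
have [k _ Bx] : (\bigcup_k B k) x by rewrite BT.
by have := fx k; rewrite indicE mem_set// mulr1.
Qed.

End pi_system_ae0.

(** * Indicators and total sequences in L2 *)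

Section L2_indicators.
Context dT (T : measurableType dT) (R : realType).
Variable mu : {measure set T -> \bar R}.
Local Open Scope quotient_scope.
Implicit Types (A : set T) (c : R[i]).

Lemma indic_sqintegrable c A : measurable A -> (mu A < +oo)%E ->
  (fun x => c * ((\1_A x : R)%:C)%C) \in sqintegrable mu.
Proof.
move=> mA Afin; apply: sqintegrable_of_int.
  apply: cmeasurableM; first exact: cmeasurable_cst.
  by split => /=; [exact: measurable_indic|exact: measurable_cst].
rewrite (eq_integral (fun x => (cabs c ^+ 2)%:E * (\1_A x)%:E)%E); last first.
  move=> x _; rewrite -EFinM cabsM exprMn; congr ((_ * _)%:E).
  rewrite [LHS]cabs_sq /= expr0n addr0 indicE.
  by case: (x \in A); rewrite ?expr1n ?expr0n.
rewrite ge0_integralZl//.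
- by rewrite integral_indic// setIT lte_mul_pinfty// lee_fin sqr_ge0.
- by apply/measurable_EFinP; exact: measurable_indic.
- by rewrite lee_fin sqr_ge0.
Qed.

Definition L2indic c A (mA : measurable A) (Afin : (mu A < +oo)%E) : L2fun mu :=
  L2Fun (indic_sqintegrable c mA Afin).

Lemma L2dot_pi (h : L2 mu) (g : L2fun mu) :
  L2dot h (\pi_(L2 mu) g) = cintegral mu (fun x => L2repr h x * (g x)^*).
Proof.
apply: L2dot_ae; [exact: L2repr_cmeasurable|exact: L2fun_cmeasurable| |].
  exact: nearW.
exact: L2repr_pi.
Qed.

Lemma L2_neq0 A : measurable A -> (0 < mu A)%E -> (mu A < +oo)%E ->
  exists f : L2 mu, f != 0.
Proof.
move=> mA A0 Afin; exists (\pi_(L2 mu) (L2indic 1 mA Afin)).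
apply: contraTneq A0 => f0; rewrite -leNgt.
have := congr1 (hnorm (@L2dot _ _ _ mu)) f0.
rewrite hnorm_pi (nrm0 (L2_hilbert mu)) => n0.
have := L2norm2 (L2indic 1 mA Afin); rewrite n0 expr0n /=.
rewrite (eq_integral (fun x => (\1_A x)%:E)); last first.
  move=> x _; rewrite /L2indic/= mul1r [in LHS]cabs_sq /= expr0n addr0 indicE.
  by case: (x \in A); rewrite ?expr1n ?expr0n.
by rewrite integral_indic// setIT => <-.
Qed.

Lemma L2_total (B : (set T)^nat) :
  (forall k, measurable (B k)) -> (forall k, (mu (B k) < +oo)%E) ->
  setI_closed (range B) -> @measurable _ T = <<s range B >> ->
  \bigcup_k B k = setT ->
  exists e : nat -> L2 mu, total_seq (@L2dot _ _ _ mu) e.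
Proof.
move=> mB Bfin BI BE BT.
(* Even indices test the real part of [h], odd ones, through the factor i, its imaginary part. *)
exists (fun n => \pi_(L2 mu) (L2indic (if odd n then 'i%C else 1) (mB n./2) (Bfin n./2))).
move=> h h0.
have key (c : R[i]) :
    (forall k, rdot (@L2dot _ _ _ mu) h
      (\pi_(L2 mu) (L2indic c (mB k) (Bfin k))) = 0) ->
    {ae mu, forall x, complex.Re (L2repr h x * c^*) = 0}.
  move=> hc; apply: (pi_ae0 BI BE BT).
  - by have [] : cmeasurable (fun x => L2repr h x * c^*) by
      exact: cmeasurableM (L2repr_cmeasurable h) (cmeasurable_cst _ _).
  - move=> k; have [+ _] := L2fun_integrableM (repr h) (L2indic c (mB k) (Bfin k)).
    apply: eq_integrable => // x _ /=; congr EFin.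
    rewrite rmorphM mulrA [LHS]cReM cReJ cImJ /=.
    by rewrite oppr0 mulr0 subr0.
  - move=> k; have := hc k; rewrite /rdot L2dot_pi /cintegral /= /Rintegral => i0.
    have [ii _] := L2fun_integrableM (repr h) (L2indic c (mB k) (Bfin k)).
    have := integrable_fin_num measurableT ii; move=> /fineK.
    rewrite /= -/(L2repr h) i0 => E0; rewrite [RHS]E0.
    apply: eq_integral => x _; congr EFin.
    rewrite rmorphM mulrA [RHS]cReM cReJ cImJ /=.
    by rewrite oppr0 mulr0 subr0.
have re0 : {ae mu, forall x, complex.Re (L2repr h x) = 0}.
  have := key 1; move=> /(_ _)/wrap[].
    by move=> k; have := h0 k.*2; rewrite odd_double doubleK.
  by apply: filterS => x; rewrite rmorph1 mulr1.
have im0 : {ae mu, forall x, complex.Im (L2repr h x) = 0}.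
  have := key 'i%C; move=> /(_ _)/wrap[].
    by move=> k; have := h0 k.*2.+1; rewrite /= odd_double/= uphalf_double.
  apply: filterS => x; rewrite cReM cReJ cImJ /= mulr0 sub0r mulrN1 opprK.
  exact.
rewrite -(reprK h) -[RHS](_ : \pi_(L2 mu) 0 = 0); last by rewrite raddf0.
by apply/L2piP; apply: filterS2 re0 im0 => x r0 i0; apply: complex_ext; [exact: r0|exact: i0].
Qed.

End L2_indicators.

(** * Rational boxes generate the sigma-algebra of R^d *)

Section rational_boxes.
Variables (R : realType) (d : nat).
Local Notation leb := (lebesgue_rV R d).
Implicit Types a b : {ffun 'I_d -> rat}.

Definition box a b : set 'rV[R]_d :=
  [set x | forall i, ratr (a i) < x ord0 i <= ratr (b i)].

(** Corners are finite functions because these form a countable type. They need not be ordered, so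
    empty boxes occur and intersecting two boxes requires no case distinction; codes that decode to
    nothing give the empty set. *)
Definition nth_box (k : nat) : set 'rV[R]_d :=
  if unpickle k is Some (a, b) then box a b else set0.

Lemma nth_box_pickle a b : nth_box (pickle (a, b)) = box a b.
Proof. by rewrite /nth_box pickleK. Qed.

Lemma measurable_box a b : measurable (box a b).
Proof.
rewrite (_ : box a b = \bigcap_(i in setT)
    [set x : 'rV[R]_d | x ord0 i \in `]ratr (a i), ratr (b i)]]).
  apply: fin_bigcap_measurable => [|i _]; first exact: finite_finset.
  have := @measurable_coord R d i measurableT `]ratr (a i), ratr (b i)]%classic.
  by rewrite setTI; apply; exact: measurable_itv.
apply/seteqP; split => x /= xab i; first by move=> _; rewrite /= in_itv/=; exact: xab.
by have := xab i I; rewrite /= in_itv.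
Qed.

Lemma measurable_nth_box k : measurable (nth_box k).
Proof. by rewrite /nth_box; case: unpickle => [[a b]|//]; exact: measurable_box. Qed.

Lemma nth_box_lty k : (leb (nth_box k) < +oo)%E.
Proof.
rewrite /nth_box; case: unpickle => [[a b]|]; last by rewrite measure0.
have [ab|/existsNP[i abi]] := pselect (forall i, (ratr (a i) : R) <= ratr (b i)).
  rewrite (_ : box a b = [set x | forall i, (\row_i (ratr (a i) : R)) ord0 i <
      x ord0 i <= (\row_i (ratr (b i) : R)) ord0 i]).
    by rewrite lebesgue_rV_box ?ltry// => i; rewrite !mxE.
  by apply/seteqP; split => x /= xab i; have := xab i; rewrite !mxE.
rewrite (_ : box a b = set0) ?measure0//; apply/seteqP; split=> // x /(_ i).
by move=> /andP[ax xb]; apply: abi; rewrite (le_trans (ltW ax)).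
Qed.

Lemma nth_boxI : setI_closed (range nth_box).
Proof.
have rmax (p q : rat) : ratr (Num.max p q) = Num.max (ratr p) (ratr q) :> R.
  by case: leP => pq; [rewrite max_r// ler_rat|rewrite max_l// ler_rat ltW].
have rmin (p q : rat) : ratr (Num.min p q) = Num.min (ratr p) (ratr q) :> R.
  by case: leP => pq; [rewrite min_l// ler_rat|rewrite min_r// ler_rat ltW].
move=> _ _ [k _ <-] [l _ <-].
rewrite {2 3}/nth_box.
case kE : (unpickle k : option ({ffun 'I_d -> rat} * {ffun 'I_d -> rat})) =>
    [[a b]|]; last by rewrite set0I; exists k; rewrite // /nth_box kE.
case lE : (unpickle l : option ({ffun 'I_d -> rat} * {ffun 'I_d -> rat})) =>
    [[a' b']|]; last by rewrite setI0; exists l; rewrite // /nth_box lE.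
exists (pickle ([ffun i => Num.max (a i) (a' i)], [ffun i => Num.min (b i) (b' i)])) => //.
rewrite nth_box_pickle; apply/seteqP; split => [x xab|x [xab xab'] i].
  split=> i; have := xab i; rewrite !ffunE rmax rmin gt_max le_min.
    by move=> /andP[/andP[-> _] /andP[-> _]].
  by move=> /andP[/andP[_ ->] /andP[_ ->]].
rewrite !ffunE rmax rmin gt_max le_min.
by have /andP[-> ->] := xab i; have /andP[-> ->] := xab' i.
Qed.

Definition ffun_upd a (i : 'I_d) (q : rat) : {ffun 'I_d -> rat} :=
  [ffun j => if j == i then q else a j].

Lemma big_box (x : 'rV[R]_d) : exists n : nat, forall i, `|x ord0 i| < n%:R.
Proof.
pose M : R := \sum_i `|x ord0 i|; exists (Num.trunc M).+1 => i.
apply: le_lt_trans (truncnS_gt M).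
by rewrite /M (bigD1 i)//= lerDl sumr_ge0.
Qed.

Lemma nth_boxT : \bigcup_k nth_box k = setT.
Proof.
apply/seteqP; split => // x _; have [n xn] := big_box x.
exists (pickle ([ffun=> - n%:R] : {ffun 'I_d -> rat},
                [ffun=> n%:R] : {ffun 'I_d -> rat})) => //.
rewrite nth_box_pickle => i; rewrite !ffunE rmorphN/= ratr_nat.
by have := xn i; rewrite ltr_norml => /andP[-> /ltW].
Qed.

Lemma measurable_rVE : @measurable _ 'rV[R]_d = <<s range nth_box >>.
Proof.
apply/seteqP; split; last first.
  apply: smallest_sub; first exact: sigma_algebra_measurable.
  by move=> _ [k _ <-]; exact: measurable_nth_box.
pose gT := g_sigma_algebraType (range nth_box).
have mbox a b : measurable (box a b : set gT).
  by apply: sub_sigma_algebra; exists (pickle (a, b)) => //; rewrite nth_box_pickle.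
have mcoord i : measurable_fun [set: gT] (fun x : gT => (x : 'rV[R]_d) ord0 i).
  apply: (measurability _ (RGenOInfty.measurableE R)) => _ [_ [r ->] <-].
  (* The half-space where coordinate [i] exceeds [r] is a countable union of boxes: the lower bound
     in direction [i] is a rational [q > r], every other bound is [n] or its opposite. *)
  rewrite setTI (_ : _ @^-1` _ = \bigcup_(q : rat) \bigcup_(n : nat)
    if (r < ratr q) then
      box (ffun_upd [ffun=> - n%:R] i q) [ffun=> n%:R] else set0).
    apply: bigcupT_measurable_rat => q; apply: bigcupT_measurable => n.
    by case: ifP => _; [exact: mbox|exact: measurable0].
  apply/seteqP; split => [x /=|x [q _ [n _]]].
    rewrite in_itv/= andbT => /rat_in_itvoo[q]; rewrite in_itv/= => /andP[rq qx].
    have [n xn] := big_box x; exists q => //; exists n => //; rewrite rq => j.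
    rewrite !ffunE; have := xn j; rewrite ltr_norml => /andP[nx xn'].
    case: eqP => [->|_]; last by rewrite rmorphN/= ratr_nat nx ltW.
    by rewrite qx ratr_nat/=; have := xn i; rewrite ltr_norml => /andP[_ /ltW].
  case: ifP => // rq xbox /=; rewrite in_itv/= andbT.
  by have /andP[+ _] := xbox i; rewrite ffunE eqxx => /(lt_trans rq).
apply: smallest_sub; first exact: smallest_sigma_algebra.
move=> A; rewrite -bigcup_seq/= => -[i _] [Y mY <-].
exact: (mcoord i measurableT Y mY).
Qed.

Lemma L2_rV_total : exists e : nat -> L2_rV R d, total_seq (@L2dot _ _ _ leb) e.
Proof.
exact: (L2_total measurable_nth_box nth_box_lty nth_boxI measurable_rVE nth_boxT).
Qed.

(** Ensures that the supremum [Lambda] is not taken over the empty set, hence is nonnegative. *)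
Lemma L2_rV_neq0 : exists f : L2_rV R d, f != 0.
Proof.
pose a : {ffun 'I_d -> rat} := [ffun=> 0]; pose b : {ffun 'I_d -> rat} := [ffun=> 1].
have E : leb (box a b) = 1%E.
  rewrite (_ : box a b = [set x | forall i, (0 : 'rV[R]_d) ord0 i <
      x ord0 i <= (const_mx 1 : 'rV[R]_d) ord0 i]).
    rewrite lebesgue_rV_box => [|i]; last by rewrite !mxE.
    by rewrite big1// => i _; rewrite !mxE subr0.
  by apply/seteqP; split => x /= xab i; have := xab i; rewrite !ffunE !mxE rmorph0 rmorph1.
have B0 : (0 < leb (box a b))%E by rewrite E.
have Boo : (leb (box a b) < +oo)%E by rewrite E ltry.
exact: L2_neq0 (measurable_box a b) B0 Boo.
Qed.

End rational_boxes.

(** * Linear maps and isometries *)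

Section hilbert_isometry.
Variables (R : realType) (V : lmodType R[i]) (dot : V -> V -> R[i]).
Hypothesis H : is_hilbert dot.
Local Notation rd := (rdot dot).
Local Notation nrm := (hnorm dot).

Lemma dot_inj f g : (forall h, rd f h = rd g h) -> f = g.
Proof.
move=> fg; apply/subr0_eq/(rdot_eq0 H).
by rewrite rdotBl// fg subrr.
Qed.

Variable A : V -> V.
Hypothesis Alin : forall a f g, A (a *: f + g) = a *: A f + A g.

Lemma lin_fun0 : A 0 = 0.
Proof.
have := Alin 1 0 0; rewrite !scale1r addr0 => /(congr1 (fun v => v - A 0)).
by rewrite subrr addrK.
Qed.

Lemma lin_funZ a f : A (a *: f) = a *: A f.
Proof. by have := Alin a f 0; rewrite lin_fun0 !addr0. Qed.

Lemma lin_funD f g : A (f + g) = A f + A g.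
Proof. by have := Alin 1 f g; rewrite !scale1r. Qed.

Lemma isometry_dot : (forall f, nrm (A f) = nrm f) ->
  forall f g, dot (A f) (A g) = dot f g.
Proof.
move=> iso.
have isor f g : rd (A f) (A g) = rd f g.
  have := nrm2D H (A f) (A g); rewrite -lin_funD !iso nrm2D//; lra.
by move=> f g; rewrite !(rdotE H) -lin_funZ !isor.
Qed.

End hilbert_isometry.

(** * Time-frequency shifts *)

Section tfshift_theory.
Variables (R : realType) (d : nat).
Local Notation leb := (lebesgue_rV R d).
Local Notation H := (L2_rV R d).
Local Notation dot := (@L2dot _ _ R leb).
Local Notation nrm := (hnorm dot).
Implicit Types (f g h : H) (z : 'rV[R]_d * 'rV[R]_d).
Local Open Scope quotient_scope.

Lemma L2_ae_eq dT (T : measurableType dT) (mu : {measure set T -> \bar R})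
    (f g : L2 mu) : {ae mu, forall x, L2repr f x = L2repr g x} -> f = g.
Proof. by move=> fg; rewrite -[f]reprK -[g]reprK; apply/L2piP. Qed.

Lemma ae_shift (a : 'rV[R]_d) (P : 'rV[R]_d -> Prop) :
  {ae leb, forall y, P y} -> {ae leb, forall y, P (y + a)}.
Proof.
move=> [N [mN N0 PN]]; exists [set y | N (y + a)]; split.
- by have := measurable_shift a measurableT mN; rewrite setTI.
- by rewrite lebesgue_rV_shift.
- by move=> y /= nP; apply: PN.
Qed.

Lemma tfshift_linear z a f g :
  tfshift z (a *: f + g) = a *: tfshift z f + tfshift z g.
Proof.
apply: L2_ae_eq.
have e1 := ae_shift (- z.1) (L2reprD (a *: f) g).
have e2 := ae_shift (- z.1) (L2reprZ a f).
have e3 := L2reprD (a *: tfshift z f) (tfshift z g).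
have e4 := L2reprZ a (tfshift z f).
have e5 := tfshiftE z (a *: f + g).
have e6 := tfshiftE z f.
have e7 := tfshiftE z g.
apply: filterS (filterI (filterI e1 (filterI e2 e3))
  (filterI (filterI e4 e5) (filterI e6 e7))) => y.
move=> [[/= E1 [E2 E3]] [[E4 E5] [E6 E7]]].
by rewrite E3 E4 E5 E6 E7 /tfshift_fun E1 E2; ring.
Qed.

Lemma tfshift_nrm z f : nrm (tfshift z f) = nrm f.
Proof.
rewrite !hnorm_L2 !L2_normE/= (L2norm_ae (g := L2Fun
  (tfshift_fun_sqintegrable z (L2fun_sqintegrable (repr f)))) (tfshiftE z f)).
apply/eqP; rewrite -(eqrXn2 (n := 2)) ?L2norm_ge0//; apply/eqP/EFin_inj.
rewrite !L2norm2 /=.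
under eq_integral do rewrite cabsM cabs_expi mul1r.
have ms := measurable_shift (- z.1).
have mcf : measurable_fun setT (fun y => (cabs (L2repr f y) ^+ 2)%:E).
  by apply/measurable_EFinP/measurable_funX/measurable_cabs/L2repr_cmeasurable.
have /= <- := @ge0_integral_pushforward _ _ _ _ R _ ms leb setT _ measurableT mcf.
  by apply: eq_measure_integral => A mA _; exact: lebesgue_rV_shift.
by move=> y _; rewrite lee_fin sqr_ge0.
Qed.

Definition tfadj z := adjoint (tfshift z).

(** Riesz representation rules out the default value 0 of [xget]; from here on the adjoint is used
    through this identity alone. *)
Lemma tfadjP z f g : dot (tfshift z f) g = dot f (tfadj z g).
Proof.
have [h hP] := adjoint_exists (L2_hilbert leb) (A := tfshift z) (C := 1)
  (tfshift_linear z) (fun f => ltac:(rewrite mul1r tfshift_nrm; exact: lexx)) g.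
exact: (@xgetPex _ 0 [set h | forall f, dot (tfshift z f) g = dot f h] (ex_intro _ h hP)).
Qed.

Lemma rdot_tfadj z f h : rdot dot (tfadj z f) h = rdot dot (tfshift z h) f.
Proof. by rewrite rdotC; [rewrite /rdot tfadjP|exact: L2_hilbert]. Qed.

(** Makes every vector an image under [tfadj z], so an operator that vanishes after [tfadj z]
    vanishes altogether. *)
Lemma tfadjK z f : tfadj z (tfshift z f) = f.
Proof.
apply: (dot_inj (L2_hilbert leb)) => h; rewrite rdot_tfadj /rdot.
rewrite (isometry_dot (L2_hilbert leb) (tfshift_linear z) (tfshift_nrm z)).
by rewrite -/(rdot _ _ _) rdotC//; exact: L2_hilbert.
Qed.

Lemma tfadj_linear z a f g : tfadj z (a *: f + g) = a *: tfadj z f + tfadj z g.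
Proof.
have HH := L2_hilbert leb.
apply: (dot_inj HH) => h; rewrite /rdot; congr complex.Re.
rewrite (dotJ HH h) -tfadjP (dotDl HH) (dotZl HH) (dotJ HH h (tfadj z f)).
rewrite (dotJ HH h (tfadj z g)) -!tfadjP (dotJ HH (a *: f + g)) (dotDl HH) (dotZl HH).
by rewrite conjCK -!(dotJ HH (tfshift z h)).
Qed.

(** The squared norm of the adjoint applied to [f] is the pairing of its shift with [f]; apply
    Cauchy-Schwarz and divide. *)
Lemma tfadj_nrm z f : nrm (tfadj z f) <= nrm f.
Proof.
have HH := L2_hilbert leb.
have [->|n0] := eqVneq (nrm (tfadj z f)) 0; first exact: nrm_ge0.
have np : 0 < nrm (tfadj z f) by rewrite lt_neqAle eq_sym n0 nrm_ge0.
rewrite -(ler_pM2l np) -expr2 nrm2// rdot_tfadj.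
by rewrite (le_trans (ler_norm _))// (le_trans (rdot_le HH _ _))// tfshift_nrm.
Qed.

Lemma cohenE (S : H -> H) f z :
  cohen S f z = dot (S (tfadj z f)) (tfadj z f).
Proof. by rewrite /cohen /opshift/= tfadjP. Qed.

End tfshift_theory.

(** * Measurability and boundedness of the Cohen distribution *)

Section cohen_measurable.
Variables (R : realType) (d : nat).
Local Notation leb := (lebesgue_rV R d).
Local Notation H := (L2_rV R d).
Local Notation dot := (@L2dot _ _ R leb).
Local Notation nrm := (hnorm dot).
Implicit Types (f g h : H) (z : 'rV[R]_d * 'rV[R]_d).

(** Positive and negative parts are treated by Tonelli, so measurability in the parameter follows
    from joint measurability. *)
Lemma measurable_Rintegral_param d1 d2 (T1 : measurableType d1) (T2 : measurableType d2)
    (m : {sigma_finite_measure set T2 -> \bar R}) (K : T1 * T2 -> R) :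
  measurable_fun setT K ->
  measurable_fun setT (fun x => \int[m]_y K (x, y)).
Proof.
move=> mK; have mE : measurable_fun setT (EFin \o K) by exact/measurable_EFinP.
apply: (measurableT_comp (@fine_measurable R setT measurableT)) => /=.
under eq_fun do rewrite integralE.
apply: emeasurable_funB.
  rewrite (_ : (fun x => _) = fubini_F m ((EFin \o K)^\+)%E); last first.
    by apply/funext => x; apply: eq_integral => y _; rewrite !funeposE.
  by apply: measurable_fun_fubini_tonelli_F => //; exact: measurable_funepos.
rewrite (_ : (fun x => _) = fubini_F m ((EFin \o K)^\-)%E); last first.
  by apply/funext => x; apply: eq_integral => y _; rewrite !funenegE.
by apply: measurable_fun_fubini_tonelli_F => //; exact: measurable_funeneg.
Qed.

(** Moving the adjoint to the other side turns the pairing into an integral over y of a kernel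
    jointly measurable in (z, y). *)
Lemma tfadj_weakly_measurable f : weakly_measurable dot (fun z => tfadj z f).
Proof.
move=> h; under eq_fun do rewrite rdot_tfadj.
pose K (p : ('rV[R]_d * 'rV[R]_d) * 'rV[R]_d) :=
  tfshift_fun p.1 (L2repr h) p.2 * (L2repr f p.2)^*.
have [mh1 mh2] := L2repr_cmeasurable h.
have [mf1 mf2] := L2repr_cmeasurable f.
have mc i : measurable_fun setT (fun p : ('rV[R]_d * 'rV[R]_d) * 'rV[R]_d => p.2 ord0 i).
  exact: (measurableT_comp (measurable_coord i) measurable_snd).
have mc1 i : measurable_fun setT (fun p : ('rV[R]_d * 'rV[R]_d) * 'rV[R]_d => p.1.1 ord0 i).
  apply: (measurableT_comp (measurable_coord i)).
  exact: (measurableT_comp measurable_fst measurable_fst).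
have mc2 i : measurable_fun setT (fun p : ('rV[R]_d * 'rV[R]_d) * 'rV[R]_d => p.1.2 ord0 i).
  apply: (measurableT_comp (measurable_coord i)).
  exact: (measurableT_comp measurable_snd measurable_fst).
have mK : cmeasurable K.
  apply: cmeasurableM; last first.
    apply: cmeasurableJ; split.
      exact: (measurableT_comp mf1 measurable_snd).
    exact: (measurableT_comp mf2 measurable_snd).
  apply: cmeasurableM.
    have mt : measurable_fun setT (fun p : ('rV[R]_d * 'rV[R]_d) * 'rV[R]_d =>
        2 * pi * \sum_(i < d) p.1.2 ord0 i * p.2 ord0 i).
      apply: measurable_funM => //; apply: measurable_sum => i.
      exact: measurable_funM.
    split; apply: measurableT_comp mt => //; apply: continuous_measurable_fun.
    - exact: continuous_cos.
    - exact: continuous_sin.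
  have ms : measurable_fun setT (fun p : ('rV[R]_d * 'rV[R]_d) * 'rV[R]_d => p.2 - p.1.1).
    apply/measurable_fun_rVP => i; under eq_fun do rewrite !mxE.
    exact: measurable_funB.
  by split; [exact: (measurableT_comp mh1 ms)|exact: (measurableT_comp mh2 ms)].
rewrite (_ : (fun z => _) = (fun z => \int[leb]_y complex.Re (K (z, y)))).
  have mKR : measurable_fun setT (fun p => complex.Re (K p)) by case: mK.
  exact: (measurable_Rintegral_param leb mKR).
apply/funext => z.
rewrite /rdot (L2dot_ae (F := tfshift_fun z (L2repr h)) (G := L2repr f))//.
- exact: (L2fun_cmeasurable (L2Fun
    (tfshift_fun_sqintegrable z (L2fun_sqintegrable (repr h))))).
- exact: tfshiftE.
- exact: nearW.
Qed.

Variables (S : {linear H -> H}) (C : R).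
Hypothesis C0 : 0 <= C.
Hypothesis SC : forall f, nrm (S f) <= C * nrm f.

Lemma measurable_cohen f :
  measurable_fun setT (fun z => cabs (cohen S f z)).
Proof.
have HH := L2_hilbert leb.
have [e tot] := L2_rV_total R d.
have mg := tfadj_weakly_measurable f.
have Slin a u v : S (a *: u + v) = a *: S u + S v by exact: linearP.
have mSg : weakly_measurable dot (fun z => S (tfadj z f)).
  exact: (weakly_measurable_op HH Slin SC mg).
have miSg : weakly_measurable dot (fun z => 'i%C *: S (tfadj z f)).
  apply: (weakly_measurable_op HH (A := fun v => 'i%C *: v) (C := 1)) mSg.
    by move=> a u v; rewrite scalerDr !scalerA mulrC.
  by move=> u; rewrite nrmZi// mul1r.
apply: measurable_cabs; split.
- under eq_fun do rewrite cohenE.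
  exact: (weakly_measurable_rdot HH tot mSg mg).
- under eq_fun do rewrite cohenE rdotE//=.
  apply: measurableT_comp => //.
  exact: (weakly_measurable_rdot HH tot miSg mg).
Qed.

(** Product-measurable sets are Caratheodory measurable. *)
Lemma measurable_phase_space dT (T : measurableType dT)
    (F : 'rV[R]_d * 'rV[R]_d -> T) : measurable_fun setT F ->
  measurable_fun [set: phase_space R d] (F : phase_space R d -> T).
Proof.
move=> mF _ Y mY; rewrite setTI; apply: caratheodory_measurable_mu_ext.
by have := mF measurableT Y mY; rewrite setTI.
Qed.

Lemma measurable_cohen_phase f (D : set (phase_space R d)) :
  measurable_fun D (fun z : phase_space R d => cabs (cohen S f z)).
Proof. exact: (measurable_funTS (measurable_phase_space (measurable_cohen f))). Qed.

Lemma cohen_le f z : cabs (cohen S f z) <= 2 * (C * nrm f ^+ 2).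
Proof.
have HH := L2_hilbert leb.
rewrite cohenE (le_trans (cabs_le _))// rdotE//= normrN.
have le1 a : nrm a = nrm (S (tfadj z f)) -> `|rdot dot a (tfadj z f)| <= C * nrm f ^+ 2.
  move=> aS; apply: le_trans (rdot_le HH _ _) _.
  rewrite aS expr2 mulrA ler_pM ?nrm_ge0 ?tfadj_nrm//.
  by rewrite (le_trans (SC _))// ler_wpM2l// tfadj_nrm.
have := le1 _ erefl; have := le1 _ (nrmZi HH _); lra.
Qed.

End cohen_measurable.

(** * From the normed topology of L2 to sequences of real norms *)

Section L2_topology.
Context dT (T : measurableType dT) (R : realType).
Variable mu : {measure set T -> \bar R}.
Local Notation H := (L2 mu).
Local Notation dot := (@L2dot _ _ R mu).
Local Notation nrm := (hnorm dot).
Local Notation HH := (L2_hilbert mu).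

Lemma complex_gt0 (e : R[i]) : 0 < e -> 0 < complex.Re e /\ e = ((complex.Re e)%:C)%C.
Proof.
case: e => a b; rewrite ltcE/= => /andP[/eqP -> a0].
by split.
Qed.

Lemma cvg_L2 (u : nat -> H) (f : H) :
  nrm (u n - f) @[n --> \oo] --> (0 : R) -> u n @[n --> \oo] --> f.
Proof.
move=> /nrm_cvg_lt uf; apply/cvgrPdist_lt => e /complex_gt0[e0 ->].
have [N uN] := uf _ e0; exists N => // n /uN.
by rewrite L2_normC ltcR/= nrmB//; exact: HH.
Qed.

Lemma nbhs_hball (v : H) (e : R) : 0 < e -> nbhs v [set w | nrm (v - w) < e].
Proof.
move=> e0; have eC : 0 < (e%:C)%C by rewrite ltcR.
have := nbhsx_ballx v _ eC; apply: filterS => w.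
by rewrite -ball_normE /= L2_normC ltcR.
Qed.

(** Pairing with [h] is packed as a continuous scalar functional, to which the weak convergence of
    the statement applies. *)
Lemma wcvg_weakly_cvg (u : nat -> H) (f : H) : weakly_cvg u f -> wcvg dot u f.
Proof.
move=> uf h.
pose phi (v : H) : R[i] := dot v h.
have lin : linear_for *%R phi.
  by move=> a v w; rewrite /phi (dotDl HH) (dotZl HH).
pose L := GRing.isLinear.Build _ _ _ _ phi lin.
pose phiL : {scalar H} := HB.pack phi L.
have cphi : continuous (phiL : H -> R[i]).
  move=> v; apply/(@cvgrPdist_lt _ _ _ _ (nbhs_filter v)) => e /complex_gt0[e0 ->].
  have K0 : 0 < 2 * nrm h + 1 by rewrite ltr_wpDl// mulr_ge0// nrm_ge0.
  have d0 : 0 < complex.Re e / (2 * nrm h + 1) by rewrite divr_gt0.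
  have nb := nbhs_hball v d0.
  apply: filterS nb => w /=; rewrite ltr_pdivlMr// => vw.
  rewrite /= /phi -[dot v h - _](_ : dot (v - w) h = _); last first.
    by rewrite (dotDl HH) -scaleN1r (dotZl HH) mulN1r.
  rewrite cabsE ltcR (le_lt_trans _ vw)// (le_trans (cabs_le _))// (rdotE HH) /= normrN.
  have := rdot_le HH (v - w) h; have := rdot_le HH ('i%C *: (v - w)) h.
  rewrite (nrmZi HH); have := nrm_ge0 dot (v - w). lra.
have := uf phiL cphi; move=> /cvgrPdist_lt ufL.
apply/cvgrPdist_lt => e e0; have eC : 0 < (e%:C)%C by rewrite ltcR.
apply: filterS (ufL _ eC) => n.
rewrite /= cabsE ltcR; apply: le_lt_trans.
by rewrite /rdot -cReN -cReD cabs_ge_Re.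
Qed.

(** A point approached at arbitrarily large indices; the arguments by contradiction below thereby
    avoid extracting a subsequence. *)
Lemma precompact_cluster (A : set H) (x : nat -> H) : precompact A ->
  (forall n, A (x n)) ->
  exists y, forall e N, 0 < e -> exists n, (N <= n)%N /\ nrm (x n - y) < e.
Proof.
rewrite precompactE => cA Ax.
have [|y [_ yx]] := cA (x @ \oo) _.
  by exists 0 => // n _; apply: subset_closure; exact: Ax.
exists y => e N e0.
have [|w [[n Nn <-] ny]] := yx [set x n | n in [set n | (N <= n)%N]] _ _ (nbhs_hball y e0).
  by exists N => // n Nn; exists n.
by exists n; split; rewrite // nrmB//; exact: HH.
Qed.

Lemma bounded_hball (C : R) : bounded_set [set f : H | nrm f <= C].
Proof.
exists ((C%:C)%C); split; first by rewrite complex_real.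
by move=> M CM f /= fC; rewrite L2_normC (le_trans _ (ltW CM))// lecR.
Qed.

End L2_topology.

(** * Weak and strong limits *)

Section hilbert_limits.
Variables (R : realType) (V : lmodType R[i]) (dot : V -> V -> R[i]).
Hypothesis H : is_hilbert dot.
Local Notation rd := (rdot dot).
Local Notation nrm := (hnorm dot).

(** Write the pairing as <v_n - v0, g_n> + <v0, g_n>; the first term vanishes because a weakly
    convergent sequence is bounded. *)
Lemma wcvg_rdot (v g : nat -> V) v0 g0 :
  nrm (v n - v0) @[n --> \oo] --> (0 : R) -> wcvg dot g g0 ->
  rd (v n) (g n) @[n --> \oo] --> rd v0 g0.
Proof.
move=> vv gg; have [C C0 gC] := wcvg_bounded H gg.
have e1 : rd (v n - v0) (g n) @[n --> \oo] --> (0 : R).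
  apply: norm_cvg0; apply: (@squeeze_cvgr _ _ _ _ (cst 0) (fun n => nrm (v n - v0) * C)).
  - apply: nearW => n /=; rewrite normr_ge0/= (le_trans (rdot_le H _ _))//.
    by rewrite ler_wpM2l ?nrm_ge0.
  - exact: cvg_cst.
  - by rewrite -(mul0r C); apply: cvgM vv (cvg_cst C).
have e2 : rd v0 (g n) @[n --> \oo] --> rd v0 g0.
  by under eq_fun do rewrite rdotC//; rewrite rdotC//; exact: gg.
rewrite (_ : (fun n => _) = (fun n => rd (v n - v0) (g n) + rd v0 (g n))).
  by rewrite -[rd v0 g0]add0r; exact: cvgD.
by apply/funext => n; rewrite -rdotDl// subrK.
Qed.

(** Testing the weak convergence on [f] itself bounds the squared norm of [f] by [c] times its
    norm. *)
Lemma wcvg_nrm_le (u : nat -> V) f (c : R) : wcvg dot u f ->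
  (forall n, nrm (u n) <= c) -> nrm f <= c.
Proof.
move=> uf uc; have [->|n0] := eqVneq (nrm f) 0.
  exact: le_trans (nrm_ge0 _ _) (uc 0).
have np : 0 < nrm f by rewrite lt_neqAle eq_sym n0 nrm_ge0.
rewrite -(ler_pM2l np) -expr2 nrm2//.
apply: (cvgr_to_le (uf f)); apply: nearW => n.
rewrite (le_trans (ler_norm _))// (le_trans (rdot_le H _ _))//.
by rewrite mulrC ler_wpM2l ?nrm_ge0.
Qed.

Lemma wcvg_strong (u : nat -> V) f : wcvg dot u f ->
  (forall n, nrm (u n) = nrm f) -> nrm (u n - f) @[n --> \oo] --> (0 : R).
Proof.
move=> uf un.
have n2 : nrm (u n - f) ^+ 2 @[n --> \oo] --> (0 : R).
  under eq_fun do rewrite nrm2B// un.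
  rewrite (_ : (fun n => _) = (fun n => (nrm f ^+ 2 + nrm f ^+ 2) - 2 * rd (u n) f)).
    rewrite (_ : 0 = (nrm f ^+ 2 + nrm f ^+ 2) - 2 * rd f f); last by rewrite -nrm2//; ring.
    by apply: cvgB; [exact: cvg_cst|apply: cvgM; [exact: cvg_cst|exact: uf]].
  by apply/funext => n; ring.
apply/cvg0P => e e0; have /cvg0P/(_ (e ^+ 2)) := n2; rewrite exprn_gt0// => /(_ isT)[M MP].
exists M => n /MP; rewrite ger0_norm ?sqr_ge0// ger0_norm ?nrm_ge0//.
by rewrite ltr_sqr ?nnegrE ?nrm_ge0// ltW.
Qed.

Variables (A : V -> V) (C : R).
Hypothesis Alin : forall a f g, A (a *: f + g) = a *: A f + A g.
Hypothesis AC : forall f, nrm (A f) <= C * nrm f.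

Lemma ker_closed_subspace : closed_subspace dot [set f | A f = 0].
Proof.
split => /= [|r f g|f cl]; first exact: lin_fun0 Alin.
  by move=> Af Ag; rewrite Alin Af Ag scaler0 addr0.
apply: (nrm_eq0 H); apply/eqP; rewrite eq_le nrm_ge0 andbT.
apply/ler_addgt0Pr => e e0; rewrite add0r.
have C0 : 0 < `|C| + 1 by rewrite ltr_wpDl.
have [g Ag fg] := cl _ (divr_gt0 e0 C0).
have := AC (f - g).
rewrite (_ : A (f - g) = A f); last first.
  by rewrite -scaleN1r (lin_funD Alin) (lin_funZ Alin) Ag scaler0 addr0.
move=> /le_trans; apply.
move: fg; rewrite ltr_pdivlMr// => /ltW; apply: le_trans.
by rewrite mulrC ler_wpM2l ?nrm_ge0// (le_trans (ler_norm C))// lerDl.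
Qed.

Lemma wcvg_op u f : wcvg dot u f -> wcvg dot (A \o u) (A f).
Proof.
move=> uf h; have [h' hP] := adjoint_exists H Alin AC h.
rewrite /rdot hP; under eq_fun do rewrite /= hP; exact: uf.
Qed.

End hilbert_limits.

(** * Compact operators *)

Section compact_operators.
Context dT (T : measurableType dT) (R : realType).
Variable mu : {measure set T -> \bar R}.
Local Notation H := (L2 mu).
Local Notation dot := (@L2dot _ _ R mu).
Local Notation nrm := (hnorm dot).
Let HH : is_hilbert dot := L2_hilbert mu.
Variable S : {linear H -> H}.
Hypothesis Scomp : compact_operator S.

Lemma compact_operator_bounded :
  exists2 C, 0 <= C & forall f, nrm (S f) <= C * nrm f.
Proof.
apply: contrapT => nb.
have large (n : nat) : exists f, nrm f = 1 /\ n%:R < nrm (S f).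
  apply: contrapT => nf; apply: nb; exists n%:R => // f; rewrite leNgt; apply/negP => fS.
  have f0 : nrm f != 0.
    apply: contraTneq fS => f0; rewrite (nrm_eq0 HH f0) linear0 (nrm0 HH) mulr0 ltxx.
    by [].
  have fp : 0 < nrm f by rewrite lt_neqAle eq_sym f0 nrm_ge0.
  apply: nf; exists (((nrm f)^-1%:C)%C *: f); rewrite linearZ/= !nrmZ//.
  rewrite ger0_norm ?invr_ge0 ?nrm_ge0// mulVf//; split => //.
  by rewrite mulrC ltr_pdivlMr.
have [g gP] := choice large.
have [|y yP] := precompact_cluster (Scomp (bounded_hball mu 1)) (x := S \o g).
  by move=> n; exists (g n) => //=; have [-> _] := gP n.
(* Such an [n] exceeds the norm of [y] plus 1, yet the image of [g n] has norm above [n] and lies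
   within 1 of [y]. *)
have [n [nN ny]] := yP 1 (Num.trunc (nrm y + 1)).+1 ltr01.
have [_ nS] := gP n.
have := nrm_leD HH (S (g n)) y; have := truncnS_gt (nrm y + 1).
have : ((Num.trunc (nrm y + 1)).+1%:R : R) <= n%:R by rewrite ler_nat.
move: ny nS => /=; lra.
Qed.

(** Otherwise some images stay at distance [e] from [S f]; by compactness they have a strong cluster
    point, and weak continuity of [S] identifies it with [S f]. *)
Lemma compact_operator_wcvg (u : nat -> H) f : wcvg dot u f ->
  nrm (S (u n) - S f) @[n --> \oo] --> (0 : R).
Proof.
move=> uf; apply: contrapT => /cvg0P/existsNP[e /not_implyP[e0 /forallNP nN]].
have [C C0 SC] := compact_operator_bounded.
have [M M0 uM] := wcvg_bounded HH uf.
have far (N : nat) : exists n, (N <= n)%N /\ e <= nrm (S (u n) - S f).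
  have /existsNP[n /not_implyP[Nn]] := nN N.
  by rewrite ger0_norm ?nrm_ge0// => /negP; rewrite -leNgt; exists n.
have [k kP] := choice far.
have [|y yP] := precompact_cluster (Scomp (bounded_hball mu M)) (x := S \o u \o k).
  by move=> n; exists (u (k n)) => //=; exact: uM.
have ySf : y = S f.
  apply: (dot_inj HH) => h; apply/subr0_eq; rewrite -rdotBl//.
  apply/eqP; rewrite -normr_le0; apply/ler_addgt0Pr => a a0; rewrite add0r.
  have h0 : 0 < nrm h + 1 by rewrite ltr_wpDl ?nrm_ge0.
  have a2 : 0 < a / 2 by rewrite divr_gt0.
  have Slin b v w : S (b *: v + w) = b *: S v + S w by exact: linearP.
  have Suf : wcvg dot (S \o u) (S f) := wcvg_op HH Slin SC uf.
  have /cvgrPdist_lt/(_ _ a2)[N _ NP] := Suf h.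
  have [n [Nn ny]] := yP _ N (divr_gt0 a2 h0).
  have kN : (N <= k n)%N by have [nk _] := kP n; exact: leq_trans nk.
  have := NP _ kN; rewrite /= distrC -rdotBl//.
  have := rdot_le HH (y - S (u (k n))) h.
  have : nrm (y - S (u (k n))) * nrm h <= a / 2.
    move: ny; rewrite ltr_pdivlMr//= nrmB// => /ltW; apply: le_trans.
    by rewrite ler_wpM2l ?nrm_ge0// lerDl.
  have := ler_normD (rdot dot (y - S (u (k n))) h) (rdot dot (S (u (k n)) - S f) h).
  rewrite -rdotDl// addrA subrK.
  lra.
have [n [_ ny]] := yP e 0 e0; have [_ en] := kP n.
by move: ny en; rewrite /= ySf => /lt_geF ->.
Qed.

End compact_operators.

(** * The concentration functional *)

(** For a positive limit the power is exp(r ln x); the limit 0, where ln is of no help, is handled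
    directly. *)
Lemma cvg_powR (R : realType) (r : R) (x : nat -> R) (l : R) : 0 < r ->
  (forall n, 0 <= x n) -> 0 <= l -> x n @[n --> \oo] --> l ->
  x n `^ r @[n --> \oo] --> l `^ r.
Proof.
move=> r0 x0 l0 xl; have [l_eq0|ln0] := eqVneq l 0.
  rewrite l_eq0 powR0 ?gt_eqF//; apply/cvg0P => e e0.
  have e'0 : 0 < e `^ r^-1 by rewrite powR_gt0.
  move: xl; rewrite l_eq0 => /cvg0P/(_ _ e'0)[N NP]; exists N => n /NP.
  rewrite !ger0_norm ?powR_ge0// => xe.
  have : x n `^ r < (e `^ r^-1) `^ r by apply: gt0_ltr_powR; rewrite ?nnegrE ?(ltW e'0).
  by rewrite -powRrM mulVf ?gt_eqF// powRr1// ltW.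
have lp : 0 < l by rewrite lt_neqAle eq_sym ln0.
have lnx : ln (x n) @[n --> \oo] --> ln l.
  exact: (cvg_comp _ _ xl (continuous_ln lp)).
have ex : expR (r * ln (x n)) @[n --> \oo] --> expR (r * ln l).
  have rln : r * ln (x n) @[n --> \oo] --> r * ln l.
    by apply: cvgM => //; exact: cvg_cst.
  exact: (cvg_comp _ _ rln (@continuous_expR R _)).
rewrite {2}/powR (negbTE ln0); apply: cvg_trans ex; apply: near_eq_cvg.
have /cvgrPdist_lt/(_ _ lp) := xl; apply: filterS => n /= nl.
rewrite /powR gt_eqF//; move: nl; rewrite ltr_norml => /andP[_]; lra.
Qed.

Lemma cvg_sqr (R : realType) (x : nat -> R) (l : R) :
  x n @[n --> \oo] --> l -> x n ^+ 2 @[n --> \oo] --> l ^+ 2.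
Proof.
by move=> xl; rewrite expr2; under eq_fun do rewrite expr2; exact: cvgM.
Qed.

Lemma fineZ (R : realType) (k : R) (x y : \bar R) :
  x = (k%:E * y)%E -> y \is a fin_num -> fine x = k * fine y.
Proof. by move=> -> yfin; rewrite fineM. Qed.

Section concentration_theory.
Variables (R : realType) (d : nat).
Local Notation leb := (lebesgue_rV R d).
Local Notation H := (L2_rV R d).
Local Notation dot := (@L2dot _ _ R leb).
Local Notation nrm := (hnorm dot).
Let HH : is_hilbert dot := L2_hilbert leb.
Variables (S : {linear H -> H}) (p : R) (Omega : set (phase_space R d)).
Hypotheses (Scomp : compact_operator S) (p_ge1 : 1 <= p) (mOmega : measurable Omega).
Hypothesis Omega_fin : (phase_measure R d Omega < +oo)%E.

Let p0 : 0 < p. Proof. exact: lt_le_trans p_ge1. Qed.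
Local Notation J := (concentration p Omega S).
Local Notation I f := (\int[phase_measure R d]_(z in Omega) (cabs (cohen S f z) `^ p)%:E)%E.

Lemma measurable_cohen_powR f :
  measurable_fun Omega (fun z : phase_space R d => (cabs (cohen S f z) `^ p)%:E).
Proof.
have [C C0 SC] := compact_operator_bounded Scomp.
apply/measurable_EFinP.
have m1 : measurable_fun Omega (fun z : phase_space R d => cabs (cohen S f z)).
  exact: (measurable_cohen_phase SC f).
exact: (measurableT_comp (measurable_powR p) m1).
Qed.

Lemma integral_cohen_ge0 f : (0 <= I f)%E.
Proof. by apply: integral_ge0 => z _; rewrite lee_fin powR_ge0. Qed.

(* K comes from the pointwise bound |Q_S f| <= K |f|^2. *)
Lemma integral_cohen_le : exists2 K : R, 0 <= K &
  forall f, (I f <= ((K * nrm f ^+ 2) `^ p * fine (phase_measure R d Omega))%:E)%E.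
Proof.
have [C C0 SC] := compact_operator_bounded Scomp.
exists (2 * C) => [|f]; first by rewrite mulr_ge0.
rewrite EFinM fineK ?ge0_fin_numE//.
rewrite -(integral_cst (phase_measure R d) mOmega).
apply: ge0_le_integral.
- exact: mOmega.
- by move=> z _; rewrite lee_fin powR_ge0.
- exact: measurable_cohen_powR.
- exact: measurable_cst.
move=> z _; rewrite lee_fin; apply: ge0_ler_powR.
- exact: ltW.
- by rewrite nnegrE cabs_ge0.
- by rewrite nnegrE mulr_ge0 ?sqr_ge0// mulr_ge0.
- by rewrite -mulrA; exact: cohen_le C0 SC f z.
Qed.

Lemma integral_cohen_fin f : I f \is a fin_num.
Proof.
have [K _ IK] := integral_cohen_le.
by rewrite ge0_fin_numE ?integral_cohen_ge0// (le_lt_trans (IK f))// ltry.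
Qed.

Lemma concentrationE f : J f = (fine (I f) `^ p^-1)%:E.
Proof. by rewrite /concentration -{1}(fineK (integral_cohen_fin f)) poweR_EFin. Qed.

Lemma cohen_wcvg (u : nat -> H) f z : wcvg dot u f ->
  cabs (cohen S (u n) z) @[n --> \oo] --> cabs (cohen S f z).
Proof.
move=> uf.
(* The shift goes over to the test vector, which does not depend on [n]. *)
have ug : wcvg dot (fun n => tfadj z (u n)) (tfadj z f).
  move=> h; under eq_fun do rewrite rdot_tfadj rdotC//.
  by rewrite rdot_tfadj rdotC//; exact: uf.
have Sg := compact_operator_wcvg Scomp ug.
have iSg : nrm ('i%C *: S (tfadj z (u n)) - 'i%C *: S (tfadj z f)) @[n --> \oo] --> (0 : R).
  by under eq_fun do rewrite -scalerBr nrmZi//.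
have c1 := wcvg_rdot HH Sg ug.
have c2 := wcvg_rdot HH iSg ug.
under eq_fun do rewrite cabs_sqrt cohenE rdotE// /= sqrrN.
rewrite cabs_sqrt cohenE rdotE// /= sqrrN.
apply: continuous_cvg; first exact: sqrt_continuous.
exact: cvgD (cvg_sqr c1) (cvg_sqr c2).
Qed.

Lemma concentration_wcvg (u : nat -> H) f : wcvg dot u f ->
  J (u n) @[n --> \oo] --> J f.
Proof.
move=> uf; rewrite concentrationE; under eq_fun do rewrite concentrationE.
have [C C0 SC] := compact_operator_bounded Scomp.
have [M M0 uM] := wcvg_bounded HH uf.
have Icvg : I (u n) @[n --> \oo] --> I f.
  (* The dominating function is a constant built from the norm bound [M] of the sequence; it is
     integrable because [Omega] has finite measure. *)
  apply: (@dominated_cvg _ (phase_space R d) R (phase_measure R d) Omega mOmega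
    (fun n z => (cabs (cohen S (u n) z) `^ p)%:E) (fun z => (cabs (cohen S f z) `^ p)%:E)
    (cst ((2 * (C * M ^+ 2)) `^ p)%:E)).
  - by move=> n; exact: measurable_cohen_powR.
  - move=> z Oz; apply: cvg_EFin; first exact: nearW.
    apply: cvg_powR => //; [by move=> n; exact: cabs_ge0|exact: cabs_ge0|].
    exact: cohen_wcvg.
  - by [].
  - apply/integrableP; split; first exact: measurable_cst.
    by rewrite integral_cst// lte_mul_pinfty// abse_ge0.
  - move=> n z Oz /=; rewrite lee_fin ger0_norm ?powR_ge0//.
    apply: ge0_ler_powR; rewrite ?nnegrE ?cabs_ge0 ?(ltW p0)//.
      by rewrite mulr_ge0// mulr_ge0// sqr_ge0.
    apply: le_trans (cohen_le C0 SC _ _) _.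
    by rewrite !ler_wpM2l// ler_sqr ?nnegrE ?nrm_ge0.
apply: cvg_EFin; first exact: nearW.
apply: cvg_powR.
- by rewrite invr_gt0.
- by move=> n; rewrite fine_ge0 ?integral_cohen_ge0.
- by rewrite fine_ge0 ?integral_cohen_ge0.
- by apply: fine_cvg; rewrite fineK ?integral_cohen_fin.
Qed.

Lemma concentration_ge0 f : (0 <= J f)%E.
Proof. by rewrite concentrationE lee_fin powR_ge0. Qed.

Lemma concentrationZ (c : R) f : 0 <= c -> J ((c%:C)%C *: f) = ((c ^+ 2)%:E * J f)%E.
Proof.
move=> c0.
have IZ : I ((c%:C)%C *: f) = (((c ^+ 2) `^ p)%:E * I f)%E.
  transitivity (\int[phase_measure R d]_(z in Omega)
      (((c ^+ 2) `^ p)%:E * (cabs (cohen S f z) `^ p)%:E))%E; last first.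
    apply: ge0_integralZl; [exact: mOmega|exact: measurable_cohen_powR| |].
      by move=> z _; rewrite lee_fin powR_ge0.
    by rewrite lee_fin powR_ge0.
  apply: eq_integral => z _; rewrite -EFinM -powRM ?sqr_ge0 ?cabs_ge0//.
  congr ((_ `^ _)%:E); rewrite !cohenE.
  rewrite (lin_funZ (tfadj_linear z)) linearZ/= (dotZl HH) (dotJ HH (_ *: _)) (dotZl HH).
  rewrite rmorphM/= -(dotJ HH) mulrA cabsM; congr (_ * _).
  rewrite cabsM cabs_sqrt /= expr0n addr0 sqrtr_sqr ger0_norm// cabs_sqrt/=.
  by rewrite oppr0 expr0n addr0 sqrtr_sqr ger0_norm.
have fIZ : fine (I ((c%:C)%C *: f)) = (c ^+ 2) `^ p * fine (I f).
  exact: fineZ IZ (integral_cohen_fin f).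
rewrite (concentrationE (_ *: f)) fIZ (concentrationE f) -EFinM.
have := fine_ge0 (integral_cohen_ge0 f); move: (fine _) => i i0.
rewrite powRM ?powR_ge0//; congr (_ * _)%:E.
by rewrite -powRrM mulfV ?gt_eqF// powRr1// sqr_ge0.
Qed.

End concentration_theory.

(** * Polarization *)

Section polarization.
Variables (R : realType) (V : lmodType R[i]) (dot : V -> V -> R[i]).
Hypothesis H : is_hilbert dot.

Lemma dotDr f g h : dot h (f + g) = dot h f + dot h g.
Proof. by rewrite (dotJ H (f + g)) (dotDl H) rmorphD/= -!(dotJ H). Qed.

Lemma dotZr a f h : dot h (a *: f) = a^* * dot h f.
Proof. by rewrite (dotJ H (a *: f)) (dotZl H) rmorphM/= -!(dotJ H). Qed.

(** With X = <Aa, b> and Y = <Ab, a>, the sum gives X + Y = 0 and the rotated sum gives i(Y - X) =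
    0, whence X = 0. *)
Lemma polarization_eq0 (A : V -> V) a b :
  (forall c f g, A (c *: f + g) = c *: A f + A g) ->
  dot (A a) a = 0 -> dot (A b) b = 0 -> dot (A (a + b)) (a + b) = 0 ->
  dot (A (a + 'i%C *: b)) (a + 'i%C *: b) = 0 -> dot (A a) b = 0.
Proof.
move=> lin aa bb ab aib.
move: ab; rewrite (lin_funD lin) (dotDl H) !dotDr aa bb add0r addr0 => XY.
move: aib; rewrite (lin_funD lin) (lin_funZ lin) (dotDl H) (dotZl H) !dotDr !dotZr.
rewrite aa bb !mulr0 addr0 add0r.
have -> : dot (A b) a = - dot (A a) b by apply/eqP; rewrite -addr_eq0 addrC XY.
move: (dot (A a) b) => [x y] [/= ex ey].
by apply: complex_ext => /=; lra.
Qed.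

End polarization.

(** * Vanishing of the concentration forces the operator to vanish *)

Section positivity.
Variables (R : realType) (d : nat).
Local Notation leb := (lebesgue_rV R d).
Local Notation H := (L2_rV R d).
Local Notation dot := (@L2dot _ _ R leb).
Local Notation nrm := (hnorm dot).
Let HH : is_hilbert dot := L2_hilbert leb.
Variables (S : {linear H -> H}) (p : R) (Omega : set (phase_space R d)).
Hypotheses (Scomp : compact_operator S) (p_ge1 : 1 <= p) (mOmega : measurable Omega).
Hypothesis Omega_gt0 : (0 < phase_measure R d Omega)%E.
Hypothesis Omega_fin : (phase_measure R d Omega < +oo)%E.
Local Notation J := (concentration p Omega S).
Local Notation mu := (phase_measure R d).

Lemma concentration_eq0_ae f : J f = 0%E ->
  {ae mu, forall z, Omega z -> cohen S f z = 0}.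
Proof.
rewrite concentrationE// => -[/powR_eq0_eq0 If0].
have mc : measurable_fun Omega (fun z => (cabs (cohen S f z) `^ p)%:E).
  exact: measurable_cohen_powR.
have I0 : (\int[mu]_(z in Omega) `|(cabs (cohen S f z) `^ p)%:E| = 0)%E.
  transitivity (\int[mu]_(z in Omega) (cabs (cohen S f z) `^ p)%:E)%E.
    by apply: eq_integral => z _; rewrite gee0_abs// lee_fin powR_ge0.
  have := integral_cohen_fin Scomp p_ge1 mOmega Omega_fin f.
  by move=> /fineK <-; rewrite If0.
have := (ae_eq_integral_abs mu mOmega mc).1 I0.
move=> ae0; apply: filterS ae0 => z /= zO Oz.
by have [/powR_eq0_eq0/cabs_eq0] := zO Oz.
Qed.

Lemma ae_gt0_exists (P : phase_space R d -> Prop) :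
  {ae mu, forall z, Omega z -> P z} -> exists2 z, Omega z & P z.
Proof.
move=> [N [mN N0 PN]]; apply: contrapT => nex.
move: Omega_gt0; rewrite ltNge; apply/negP; rewrite negbK -N0.
apply: le_measure; rewrite ?inE// => z Oz; apply: PN => /= OP.
by apply: nex; exists z => //; exact: OP.
Qed.

Lemma concentration_eq0 : (forall f, J f = 0%E) -> forall h, S h = 0.
Proof.
move=> J0; have [e tot] := L2_rV_total R d.
have ae0 f := concentration_eq0_ae (J0 f).
have Slin b v w : S (b *: v + w) = b *: S v + S w by exact: linearP.
(* For each pair of indices these are the vectors that polarization asks for, except [e l], which is
   supplied by the pair [l], [l]. *)
have [z _ zP] : exists2 z, Omega z & forall k l,
    [/\ cohen S (e k) z = 0, cohen S (e k + e l) z = 0 &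
        cohen S (e k + 'i%C *: e l) z = 0].
  apply: ae_gt0_exists.
  suff : {ae mu, forall z, forall k l, Omega z -> [/\ cohen S (e k) z = 0,
      cohen S (e k + e l) z = 0 & cohen S (e k + 'i%C *: e l) z = 0]}.
    by move=> ae1; apply: filterS ae1 => z zO Oz k l; exact: zO.
  apply: (ae_foralln (P := fun k z => forall l, Omega z -> [/\ cohen S (e k) z = 0,
      cohen S (e k + e l) z = 0 & cohen S (e k + 'i%C *: e l) z = 0])) => k.
  apply: (ae_foralln (P := fun l z => Omega z -> [/\ cohen S (e k) z = 0,
      cohen S (e k + e l) z = 0 & cohen S (e k + 'i%C *: e l) z = 0])) => l.
  have a1 := ae0 (e k); have a2 := ae0 (e k + e l).
  have a3 := ae0 (e k + 'i%C *: e l).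
  apply: filterS3 a1 a2 a3 => z h1 h2 h3 Oz.
  by split; [exact: h1|exact: h2|exact: h3].
have [C C0 SC] := compact_operator_bounded Scomp.
pose A f := S (tfadj z f).
have Alin b v w : A (b *: v + w) = b *: A v + A w.
  by rewrite /A tfadj_linear Slin.
have AC f : nrm (A f) <= C * nrm f.
  by apply: le_trans (SC _) _; rewrite ler_wpM2l// tfadj_nrm.
have Ae k : A (e k) = 0.
  (* Applying the isometry [tfshift z] allows testing against [e l]: the shift then returns to the
     right entry as [tfadj z (e l)], the form polarization controls. *)
  apply: (nrm_eq0 HH); rewrite -(tfshift_nrm z).
  rewrite (_ : tfshift z (A (e k)) = 0) ?nrm0//.
  apply: tot => l; rewrite /rdot tfadjP.
  have [h1 h2 h3] := zP k l; have [h4 _ _] := zP l l.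
  rewrite (polarization_eq0 HH Slin (a := tfadj z (e k)) (b := tfadj z (e l)))//.
  - by rewrite -cohenE.
  - by rewrite -cohenE.
  - by rewrite -(lin_funD (tfadj_linear z)) -cohenE.
  - by rewrite -(lin_funZ (tfadj_linear z)) -(lin_funD (tfadj_linear z)) -cohenE.
(* Since [h] is [tfadj z] of its own shift, [S h] is a value of [A], and [A] vanishes on a total
   sequence. *)
move=> h; rewrite -(tfadjK z h).
exact: (total_subspace HH tot (ker_closed_subspace HH Alin AC) Ae).
Qed.

(* Existence of maximizers and compactness of maximizing sequences *)
End positivity.

Section maximizers.
Variables (R : realType) (d : nat).
Local Notation leb := (lebesgue_rV R d).
Local Notation H := (L2_rV R d).
Local Notation dot := (@L2dot _ _ R leb).
Local Notation nrm := (hnorm dot).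
Let HH : is_hilbert dot := L2_hilbert leb.
Variables (S : {linear H -> H}) (p : R) (Omega : set (phase_space R d)).
Hypotheses (Scomp : compact_operator S) (p_ge1 : 1 <= p) (mOmega : measurable Omega).
Hypothesis Omega_fin : (phase_measure R d Omega < +oo)%E.
Local Notation J := (concentration p Omega S).
Local Notation ratio := (concentration_ratio p Omega S).
Local Notation Lam := (Lambda p Omega S).

Let p0 : 0 < p. Proof. exact: lt_le_trans p_ge1. Qed.

Let j f := fine (J f).

Let J_fin f : J f \is a fin_num.
Proof. by rewrite concentrationE. Qed.

Let JE f : J f = (j f)%:E.
Proof. by rewrite /j (fineK (J_fin f)). Qed.

Let j_ge0 f : 0 <= j f.
Proof. exact: fine_ge0 (concentration_ge0 Scomp p_ge1 mOmega Omega_fin f). Qed.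

Let jZ c f : 0 <= c -> j ((c%:C)%C *: f) = c ^+ 2 * j f.
Proof.
move=> c0.
exact: fineZ (concentrationZ Scomp p_ge1 mOmega Omega_fin f c0) (J_fin f).
Qed.

Let ratioE f : ratio f = (j f / nrm f ^+ 2)%:E.
Proof. by rewrite /concentration_ratio (JE f) -EFinM hnorm_L2. Qed.

Let j0 : j 0 = 0.
Proof. by have := jZ 0 (lexx 0); rewrite scaler0 expr0n mul0r. Qed.

Let nrm_gt0 f : f != 0 -> 0 < nrm f.
Proof.
by move=> f0; rewrite lt_neqAle nrm_ge0 andbT eq_sym; apply: contra_neq f0 => /(nrm_eq0 HH).
Qed.

Let j_normalize f : f != 0 -> j (((nrm f)^-1%:C)%C *: f) = j f / nrm f ^+ 2.
Proof. by move=> f0; rewrite jZ ?invr_ge0 ?nrm_ge0// exprVn mulrC. Qed.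

Let nrm_normalize f : f != 0 -> nrm (((nrm f)^-1%:C)%C *: f) = 1.
Proof.
move=> /nrm_gt0 f0; rewrite nrmZ// ger0_norm ?invr_ge0 ?(ltW f0)//.
by rewrite mulVf// gt_eqF.
Qed.

Let j_bounded : exists B, forall f, nrm f = 1 -> j f <= B.
Proof.
have [K K0 IK] := integral_cohen_le Scomp p_ge1 mOmega Omega_fin.
pose m := fine (phase_measure R d Omega).
exists ((K `^ p * m) `^ p^-1) => f f1.
rewrite /j concentrationE//; apply: ge0_ler_powR.
- by rewrite invr_ge0 ltW.
- by rewrite nnegrE fine_ge0// integral_cohen_ge0.
- by rewrite nnegrE mulr_ge0 ?powR_ge0// fine_ge0.
rewrite -lee_fin fineK; last exact: integral_cohen_fin.
by have := IK f; rewrite f1 expr1n mulr1.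
Qed.

Let Lam_ge0 : (0 <= Lam)%E.
Proof.
have [f f0] := L2_rV_neq0 R d.
apply: (@le_trans _ _ (ratio f)).
  by rewrite ratioE lee_fin divr_ge0 ?j_ge0 ?sqr_ge0.
by apply: ereal_sup_ubound; exists f.
Qed.

Lemma Lambda_fin_num : Lam \is a fin_num.
Proof.
have [B jB] := j_bounded.
rewrite ge0_fin_numE// (@le_lt_trans _ _ B%:E)// ?ltry//.
apply: ge_ereal_sup => _ [f f0 <-].
by rewrite ratioE -j_normalize// lee_fin jB// nrm_normalize.
Qed.

Let lam := fine Lam.
Let LamE : Lam = lam%:E. Proof. by rewrite /lam fineK// Lambda_fin_num. Qed.

Let j_le f : j f <= lam * nrm f ^+ 2.
Proof.
have [->|f0] := eqVneq f 0; first by rewrite j0 (nrm0 HH) expr0n mulr0.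
rewrite -ler_pdivrMr ?exprn_gt0 ?nrm_gt0// -lee_fin -LamE -ratioE.
by apply: ereal_sup_ubound; exists f.
Qed.

(** Common core of attainment and of compactness of maximizing sequences; the norm 1 of the weak
    limit is what [wcvg_strong] needs to upgrade the convergence. *)
Lemma maximizing_wcvg (u : nat -> H) : (0 < Lam)%E ->
  (forall n, nrm (u n) = 1) -> J (u n) @[n --> \oo] --> Lam ->
  exists (phi : nat -> nat) f, [/\ {homo phi : m n / (m < n)%N},
    wcvg dot (u \o phi) f, nrm f = 1 & ratio f = Lam].
Proof.
move=> L0 u1 uL; have [e tot] := L2_rV_total R d.
have [|phi [f [phiH uf]]] := weak_compactness HH (u := u) (C := 1) tot.
  by move=> n; rewrite u1.
exists phi, f.
have Jf : J f = Lam.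
  have c1 := concentration_wcvg Scomp p_ge1 mOmega Omega_fin uf.
  have phi_ge n : (n <= phi n)%N.
    by elim: n => // n IH; exact: leq_ltn_trans IH (phiH _ _ (ltnSn n)).
  have phi_oo : phi n @[n --> \oo] --> \oo.
    apply/cvgnyPge => A; exists A => // n /= An.
    exact: leq_trans An (phi_ge n).
  have c2 : J (u (phi n)) @[n --> \oo] --> Lam by exact: (cvg_comp _ _ phi_oo uL).
  exact: (cvg_unique _ c1 c2).
have lam0 : 0 < lam by rewrite -lte_fin -LamE.
have jf : j f = lam by rewrite /j Jf.
have f1 : nrm f = 1.
  apply/eqP; rewrite eq_le; apply/andP; split.
    by apply: (wcvg_nrm_le HH uf) => n /=; rewrite u1.
  rewrite -(ler_pXn2r (n := 2)) ?nnegrE ?nrm_ge0// expr1n.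
  by have := j_le f; rewrite jf -{1}[lam]mulr1 ler_pM2l.
by split => //; rewrite ratioE f1 expr1n divr1 jf LamE.
Qed.

Lemma maximizer_exists : exists2 f : H, f != 0 & ratio f = Lam.
Proof.
(* Ratios are nonnegative and at most [Lam], so when [Lam] is not positive every nonzero vector
   attains it. *)
have [L0|L0] := leP Lam 0%E.
  have [f f0] := L2_rV_neq0 R d; exists f => //.
  apply/eqP; rewrite eq_le; apply/andP; split.
    by apply: ereal_sup_ubound; exists f.
  by rewrite (le_trans L0)// ratioE lee_fin divr_ge0 ?j_ge0 ?sqr_ge0.
have apx (n : nat) : exists f, nrm f = 1 /\ lam - n.+1%:R^-1 < j f.
  have n0 : 0 < (n.+1%:R : R)^-1 by rewrite invr_gt0.
  have [_ [f f0 <-]] := ub_ereal_sup_adherent n0 Lambda_fin_num.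
  rewrite -/Lam LamE ratioE -EFinB lte_fin => lt.
  exists (((nrm f)^-1%:C)%C *: f); rewrite nrm_normalize// j_normalize//.
have [u uP] := choice apx.
have u1 n : nrm (u n) = 1 by have [] := uP n.
have uL : J (u n) @[n --> \oo] --> Lam.
  under eq_fun do rewrite JE; rewrite LamE.
  apply: cvg_EFin; first exact: nearW.
  apply: (@squeeze_cvgr _ _ _ _ (fun n => lam - n.+1%:R^-1) (cst lam)).
  - apply: nearW => n /=; have [_ /ltW ->] := uP n.
    by have := j_le (u n); rewrite u1 expr1n mulr1.
  - rewrite -[X in _ --> X]subr0; apply: cvgB; first exact: cvg_cst.
    exact: cvg_harmonic.
  - exact: cvg_cst.
have [phi [f [_ _ f1 fL]]] := maximizing_wcvg L0 u1 uL.
exists f => //; apply: contra_eq_neq f1 => ->.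
by rewrite (nrm0 HH) eq_sym oner_neq0.
Qed.

Hypothesis Omega_gt0 : (0 < phase_measure R d Omega)%E.

Lemma Lambda_gt0 : (S : H -> H) <> (fun=> 0) -> (0 < Lam)%E.
Proof.
move=> S0; rewrite lt_neqAle Lam_ge0 andbT; apply/eqP => L0; apply: S0.
apply/funext; apply: (concentration_eq0 Scomp p_ge1 mOmega Omega_gt0 Omega_fin) => f.
apply/eqP; rewrite (JE f) eqe eq_le j_ge0 andbT.
by have := j_le f; rewrite /lam -L0 mul0r.
Qed.

End maximizers.

Theorem theorem1p1 (R : realType) (d : nat)
    (S : {linear L2_rV R d -> L2_rV R d})
    (p : R) (Omega : set (phase_space R d))
    (S_compact : compact_operator S)
    (p_ge1 : 1 <= p)
    (mOmega : measurable Omega)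
    (Omega_gt0 : (0 < phase_measure R d Omega)%E)
    (Omega_fin : (phase_measure R d Omega < +oo)%E) :
  [/\ forall f : L2_rV R d,
        (0 <= concentration p Omega S f < +oo)%E,
      forall (u : nat -> L2_rV R d) (f : L2_rV R d),
        weakly_cvg u f ->
        concentration p Omega S (u n) @[n --> \oo] -->
          concentration p Omega S f,
      exists2 f : L2_rV R d,
        f != 0 & concentration_ratio p Omega S f = Lambda p Omega S
    & (S : L2_rV R d -> L2_rV R d) <> (fun=> 0) ->
      forall u : nat -> L2_rV R d,
        (forall n, `|u n| = 1) ->
        concentration p Omega S (u n) @[n --> \oo] --> Lambda p Omega S ->
        exists (phi : nat -> nat) (f : L2_rV R d),
          [/\ {homo phi : m n / (m < n)%N},
              u (phi n) @[n --> \oo] --> f,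
              f != 0
            & concentration_ratio p Omega S f = Lambda p Omega S]].
Proof.
have HH := L2_hilbert (lebesgue_rV R d).
split.
- move=> f; rewrite (concentration_ge0 S_compact p_ge1 mOmega Omega_fin f) /=.
  by rewrite (concentrationE S_compact p_ge1 mOmega Omega_fin f) ltry.
- move=> u f /wcvg_weakly_cvg uf.
  exact: (concentration_wcvg S_compact p_ge1 mOmega Omega_fin uf).
- exact: (maximizer_exists S_compact p_ge1 mOmega Omega_fin).
- move=> S0 u u1 uL.
  have L0 := Lambda_gt0 S_compact p_ge1 mOmega Omega_fin Omega_gt0 S0.
  have nu1 n : hnorm (@L2dot _ _ _ (lebesgue_rV R d)) (u n) = 1.
    by apply: complexI; rewrite -L2_normC u1.
  have [phi [f [phiH uf f1 fL]]] :=
    maximizing_wcvg S_compact p_ge1 mOmega Omega_fin L0 nu1 uL.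
  exists phi, f; split => //.
    apply: cvg_L2; apply: (wcvg_strong HH uf) => n /=.
    by rewrite nu1 f1.
  apply: contra_eq_neq f1 => ->.
  by rewrite (nrm0 HH) eq_sym oner_neq0.
Qed.
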